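(* Let $T$ be a Tadmor--Ritt operator on a complex Banach space $X$ and let $m,n$ be integers with $0\le m\le n$. Then for any polynomial $p(z)=\sum_{k=m}^{n}a_kz^k$ with $a_k\in\mathbb{C}$, $$\|p(T)\|\le a\,C(T)\left(2\log C(T)+b+\log\frac{n+1}{m+1}\right)\cdot\|p\|_{\infty,\mathbb{D}},$$ with absolute constants $a,b$, which can be chosen, for any $s\in(0,1)$, as $$a=\frac{2e}{\pi(1-s)},\qquad b=-2\log(s)+6.$$
   Context: $X$ is a (nonzero) complex Banach space; operators are bounded and linear; $R(z,T)=(zI-T)^{-1}$; $\mathbb{D}$ is the open unit disc. An operator $T$ on $X$ is a Tadmor--Ritt operator if $\sigma(T)\subset\overline{\mathbb{D}}$ and $C(T):=\sup_{|z|>1}\|(z-1)R(z,T)\|<\infty$. For a polynomial $p$, $\|p\|_{\infty,\mathbb{D}}=\sup_{z\in\mathbb{D}}|p(z)|$. *)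

(* Defs.v *)
From Stdlib Require Import Reals Lra.
From Coquelicot Require Import Coquelicot.

Open Scope R_scope.

(* The field is [C_AbsRing], whose absolute value is [Cmod].  A bounded linear
   operator is a function satisfying Coquelicot's [is_linear], which includes
   the bound [norm (T x) <= M * norm x]. *)

(* [real] sends infinite suprema to 0, but for [is_linear T] the supremum is
   finite (lemma [op_norm_finite]). *)
Definition op_norm {X : NormedModule C_AbsRing} (T : X -> X) : R :=
  real (Lub_Rbar (fun r : R => exists x : X, norm x <= 1 /\ r = norm (T x))).

Definition zI_minus {X : NormedModule C_AbsRing} (z : C) (T : X -> X) : X -> X :=
  fun x => minus (scal z x) (T x).

Definition resolvent_set {X : NormedModule C_AbsRing} (T : X -> X) (z : C) : Prop :=
  exists S : X -> X, is_linear S /\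
    (forall x, S (zI_minus z T x) = x) /\
    (forall x, zI_minus z T (S x) = x).

Definition spectrum {X : NormedModule C_AbsRing} (T : X -> X) (z : C) : Prop :=
  ~ resolvent_set T z.

(* R(z,T): meaningful only for z in the resolvent set, where it is the inverse
   of zI - T (lemma [resolvent_correct]). *)
Definition resolvent {X : CompleteNormedModule C_AbsRing} (z : C) (T : X -> X) : X -> X :=
  fun x => iota (fun y : X => zI_minus z T y = x).

(* C(T), possibly infinite; meaningful once every z with |z| > 1 is in the
   resolvent set. *)
Definition TR_const {X : CompleteNormedModule C_AbsRing} (T : X -> X) : Rbar :=
  Lub_Rbar (fun r : R => exists z : C, 1 < Cmod z /\
    r = op_norm (fun x : X => scal (z - 1)%C (resolvent z T x))).

Definition Tadmor_Ritt {X : CompleteNormedModule C_AbsRing} (T : X -> X) : Prop :=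
  is_linear T /\
  (forall z : C, spectrum T z -> Cmod z <= 1) /\
  is_finite (TR_const T).

(* Sum of a_k z^k over m <= k <= n. *)
Definition poly_eval (a : nat -> C) (m n : nat) (z : C) : C :=
  sum_n_m (fun k => (a k * Cpow z k)%C) m n.

Definition poly_op {X : NormedModule C_AbsRing} (a : nat -> C) (m n : nat)
    (T : X -> X) : X -> X :=
  fun x => sum_n_m (fun k => scal (a k) (Nat.iter k T x)) m n.

Definition disc_sup_norm (f : C -> C) : R :=
  real (Lub_Rbar (fun r : R => exists z : C, Cmod z < 1 /\ r = Cmod (f z))).

Lemma op_norm_finite (X : NormedModule C_AbsRing) (T : X -> X) :
  is_linear T ->
  is_finite (Lub_Rbar (fun r : R => exists x : X, norm x <= 1 /\ r = norm (T x))).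
Proof.
intros [_ _ [M [HM HT]]].
set (E := fun r : R => _).
destruct (Lub_Rbar_correct E) as [Hub Hlub].
assert (H1 : Rbar_le (norm (T zero)) (Lub_Rbar E)).
{ apply Hub; exists zero; split; [rewrite norm_zero; lra | easy]. }
assert (H2 : Rbar_le (Lub_Rbar E) M).
{ apply Hlub; intros r [x [Hx ->]]; simpl.
  apply Rle_trans with (1 := HT x).
  rewrite <- (Rmult_1_r M) at 2.
  apply Rmult_le_compat_l; [lra | exact Hx]. }
destruct (Lub_Rbar E); simpl in *; easy.
Qed.

Lemma resolvent_correct (X : CompleteNormedModule C_AbsRing) (T : X -> X) (z : C) :
  resolvent_set T z ->
  is_linear (resolvent z T) /\
  (forall x, resolvent z T (zI_minus z T x) = x) /\
  (forall x, zI_minus z T (resolvent z T x) = x).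
Proof.
intros [S [LS [HS1 HS2]]].
assert (HR : forall x, zI_minus z T (resolvent z T x) = x).
{ intros x; apply (iota_correct (fun y : X => zI_minus z T y = x)).
  exists (S x); split; [apply HS2 | intros y <-; apply HS1]. }
assert (E : forall x, resolvent z T x = S x).
{ intros x; rewrite <- (HS1 (resolvent z T x)), HR; reflexivity. }
split; [|split].
- destruct LS as [L1 L2 [M [HM L3]]]; split.
  + intros x y; rewrite !E; apply L1.
  + intros k x; rewrite !E; apply L2.
  + exists M; split; [exact HM | intros x; rewrite E; apply L3].
- intros x; rewrite E; apply HS1.
- exact HR.
Qed.

(* Main.v *)
Require Import Defs.
From Stdlib Require Import Reals Lra Lia Classical List.
From Coquelicot Require Import Coquelicot.
Import ListNotations.
Open Scope R_scope.

(** Write [K] for the Tadmor-Ritt constant, [P] for the supremum norm of [p],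
    and [R(z)] for the resolvent.  The operator [p(T)] is the Cauchy integral of
    [p(z) R(z) / (2 pi i)] along a curve around the spectrum, and the estimate
    comes from a good curve.  With [d] of order [1 / n] and [t] the chord
    [|cis u - 1|], take the point of argument [u] and modulus
    [1 + d - t / (16 K)]: the curve starts just outside the disc near [1] and
    enters the disc as soon as [t] exceeds [16 K d].  Three bounds hold on it.

    - A Neumann series continues the Tadmor-Ritt bound from outside the disc to
      a distance [t / (16 K)] inside it, so [|R(z)|] is at most a constant times
      [K / (d + t)] ([TR_resolvent_outside]).
    - Outside the disc [|p(z)| <= |z|^n P] and inside it [|p(z)| <= |z|^m P], by
      the maximum principle.  Hence [|p(z)|] is at most a constant times
      [exp (- m t / (16 K)) P] ([poly_eval_curve_le]).
    - The product is therefore of order [K P / t] for [t] between [1 / n] and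
      [K / m], and is cut off on both sides.  Its integral is [K P] times
      [ln (K (n + 1) / (m + 1))] up to an additive constant in the second factor
      ([weight_le_majorant], [majorant_sum_up], [majorant_sum_down]).

    The numerical constants leave room: they give the bound with [a] replaced by
    [2 e / pi] and [b] by [6] ([poly_op_le]), and the factor [1 / (1 - s)] and the
    term [- 2 ln s] only enlarge the right-hand side.

    The Cauchy integral is handled through Riemann sums, with no vector-valued
    integration.  For the trapezoidal rule, the resolvent identity turns the sum
    around a triangle into an exact third-order term ([triangle_eq]), so sums
    along the curve and along a large circle differ by a vanishing amount
    ([cauchy_resolvent]).  The equation [z R(z) = 1 + T R(z)] then produces the
    powers of [T] ([cauchy_value_power]).  The same theorem for multiplication by
    a number [w] on the complex line is a scalar Cauchy formula, and applying it
    to high powers of a polynomial proves the maximum principle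
    ([max_principle]). *)

(** * Identities in modules *)

(** Syntax for linear combinations of module elements, reflected so that their
    identities can be decided coefficient by coefficient. *)
Inductive mexpr :=
| MVar (i : nat) | MZero | MAdd (e f : mexpr) | MOpp (e : mexpr)
| MSub (e f : mexpr) | MScal (c : C) (e : mexpr).

Fixpoint mcoef (e : mexpr) (i : nat) : C :=
  match e with
  | MVar j => if Nat.eqb i j then RtoC 1 else RtoC 0
  | MZero => RtoC 0
  | MAdd e f => (mcoef e i + mcoef f i)%C
  | MOpp e => (- mcoef e i)%C
  | MSub e f => (mcoef e i - mcoef f i)%C
  | MScal c e => (c * mcoef e i)%C
  end.

Section ModuleIdentities.
Context {X : ModuleSpace C_AbsRing}.

Fixpoint mden (l : list X) (e : mexpr) : X :=
  match e with
  | MVar i => nth i l zero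
  | MZero => zero
  | MAdd e f => plus (mden l e) (mden l f)
  | MOpp e => opp (mden l e)
  | MSub e f => minus (mden l e) (mden l f)
  | MScal c e => scal c (mden l e)
  end.

Fixpoint mcomb (l : list X) (i : nat) (c : nat -> C) : X :=
  match l with
  | [] => zero
  | x :: l => plus (scal (c i) x) (mcomb l (S i) c)
  end.

Lemma mcomb_ext (l : list X) i c d :
  (forall j, c j = d j) -> mcomb l i c = mcomb l i d.
Proof.
intros E; revert i; induction l as [|x l IH]; intros i; simpl; [easy|].
now rewrite E, IH.
Qed.

Lemma plus_plus_swap {G : AbelianMonoid} (a b c d : G) :
  plus (plus a b) (plus c d) = plus (plus a c) (plus b d).
Proof.
rewrite <- !plus_assoc; f_equal; rewrite !plus_assoc; f_equal; apply plus_comm.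
Qed.

Lemma mcomb_plus (l : list X) i c d :
  plus (mcomb l i c) (mcomb l i d) = mcomb l i (fun j => (c j + d j)%C).
Proof.
revert i; induction l as [|x l IH]; intros i; simpl; [apply plus_zero_l|].
rewrite plus_plus_swap, IH; f_equal; symmetry.
exact (scal_distr_r (c i : C_AbsRing) (d i) x).
Qed.

Lemma mcomb_scal (l : list X) i (a : C) c :
  scal a (mcomb l i c) = mcomb l i (fun j => (a * c j)%C).
Proof.
revert i; induction l as [|x l IH]; intros i; simpl.
  exact (scal_zero_r (a : C_AbsRing)).
rewrite <- IH; etransitivity; [apply (scal_distr_l (a : C_AbsRing))|].
f_equal; apply (scal_assoc (a : C_AbsRing)).
Qed.

Lemma mcomb_zero (l : list X) i : mcomb l i (fun _ => RtoC 0) = zero.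
Proof.
revert i; induction l as [|x l IH]; intros i; simpl; [easy|].
rewrite IH, plus_zero_r; exact (scal_zero_l (K := C_AbsRing) x).
Qed.

Lemma mcomb_var (l : list X) i k :
  mcomb l i (fun j => if Nat.eqb j (k + i) then RtoC 1 else RtoC 0) = nth k l zero.
Proof.
revert i k; induction l as [|x l IH]; intros i k; simpl; [now destruct k|].
destruct k as [|k]; simpl.
- rewrite Nat.eqb_refl.
  transitivity (plus x (zero : X)); [|apply plus_zero_r]; f_equal.
  + exact (scal_one (K := C_AbsRing) x).
  + rewrite <- (mcomb_zero l (S i)).
    assert (G : forall m j, (i < j)%nat -> mcomb m j
      (fun j => if Nat.eqb j i then RtoC 1 else RtoC 0) = mcomb m j (fun _ => RtoC 0)).
    { clear; induction m as [|y m IH]; intros j H; simpl; [easy|].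
      replace (Nat.eqb j i) with false by (symmetry; apply Nat.eqb_neq; lia).
      now rewrite IH by lia. }
    apply G; lia.
- replace (Nat.eqb i (S (k + i))) with false by (symmetry; apply Nat.eqb_neq; lia).
  transitivity (plus (zero : X) (nth k l zero)); [|apply plus_zero_l]; f_equal.
  + exact (scal_zero_l (K := C_AbsRing) x).
  + rewrite <- (IH (S i) k); apply mcomb_ext; intros j.
    now replace (S (k + i)) with (k + S i)%nat by lia.
Qed.

Lemma mden_coef (l : list X) e : mden l e = mcomb l 0 (mcoef e).
Proof.
induction e as [j| |e IHe f IHf|e IH|e IHe f IHf|c e IH]; simpl.
- rewrite <- (mcomb_var l 0 j); apply mcomb_ext; intros i.
  now rewrite Nat.add_0_r.
- now rewrite mcomb_zero.
- now rewrite IHe, IHf, mcomb_plus.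
- rewrite IH, <- (scal_opp_one (K := C_AbsRing)).
  etransitivity; [apply (mcomb_scal l 0 (opp (one : C_AbsRing)))|].
  apply mcomb_ext; intros j; change (- (1) * mcoef e j = - mcoef e j)%C; ring.
- unfold minus; rewrite IHe, IHf, <- (scal_opp_one (K := C_AbsRing) (mcomb l 0 (mcoef f))).
  etransitivity; [apply f_equal; apply (mcomb_scal l 0 (opp (one : C_AbsRing)))|].
  rewrite mcomb_plus.
  apply mcomb_ext; intros j.
  change (mcoef e j + - (1) * mcoef f j = mcoef e j - mcoef f j)%C; ring.
- now rewrite IH, mcomb_scal.
Qed.

(** Both sides of an identity between linear combinations are determined by
    their coefficients on the atoms, so it reduces to identities in [C]. *)
Lemma module_identity (l : list X) e f :
  (forall i, (i < length l)%nat -> mcoef e i = mcoef f i) ->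
  mden l e = mden l f.
Proof.
intros H; rewrite !mden_coef.
assert (G : forall k i, (i + length k = length l)%nat ->
  mcomb k i (mcoef e) = mcomb k i (mcoef f)).
{ induction k as [|x k IH]; intros i Hi; simpl in *; [easy|].
  rewrite (H i), IH by lia; reflexivity. }
apply G; lia.
Qed.

End ModuleIdentities.

Ltac in_list x l :=
  match l with
  | nil => constr:(false)
  | x :: _ => constr:(true)
  | _ :: ?l => in_list x l
  end.
Ltac add_atom x l :=
  match in_list x l with true => l | false => constr:(x :: l) end.
Ltac index_of x l :=
  match l with
  | x :: _ => constr:(0%nat)
  | _ :: ?l => let i := index_of x l in constr:(S i)
  end.
Ltac module_atoms t l :=
  match t with
  | zero => l
  | plus ?a ?b => let l := module_atoms a l in module_atoms b l
  | minus ?a ?b => let l := module_atoms a l in module_atoms b l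
  | opp ?a => module_atoms a l
  | scal _ ?a => module_atoms a l
  | _ => add_atom t l
  end.
Ltac module_reify t l :=
  match t with
  | zero => constr:(MZero)
  | plus ?a ?b => let e := module_reify a l in let f := module_reify b l in
      constr:(MAdd e f)
  | minus ?a ?b => let e := module_reify a l in let f := module_reify b l in
      constr:(MSub e f)
  | opp ?a => let e := module_reify a l in constr:(MOpp e)
  | scal ?c ?a => let e := module_reify a l in constr:(MScal c e)
  | _ => let i := index_of t l in constr:(MVar i)
  end.
Ltac split_index i Hi :=
  destruct i as [|i];
  [ clear Hi; lazy [mcoef Nat.eqb]
  | first [ exfalso; cbn in Hi; lia | split_index i Hi ] ].
(** Leaves one equation between complex coefficients per atom, so that [field] can
    be used where [ring] is not enough. *)
Ltac module_coefs :=
  match goal with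
  | |- @eq ?T ?a ?b =>
      let l := module_atoms a (@nil T) in
      let l := module_atoms b l in
      let e := module_reify a l in
      let f := module_reify b l in
      change (mden l e = mden l f); apply module_identity;
      let i := fresh "i" in let Hi := fresh "Hi" in
      intros i Hi; split_index i Hi
  end.
Ltac module_eq := module_coefs; try ring.

(** * Norms, sums and limits in modules over [C] *)

(** The goal term is replaced through [f_equal], not by rewriting, because the same
    module operation may occur through different structure projections. *)
Ltac norm_as t :=
  refine (Rle_trans _ (norm t) _ (Req_le _ _ (f_equal norm _)) _); [module_eq|].

Section Norms.
Context {X : NormedModule C_AbsRing}.
Implicit Types x y : X.

Lemma norm_scal_C (a : C) x : norm (scal a x) <= Cmod a * norm x.
Proof. exact (norm_scal a x). Qed.

Lemma norm_scal_eq (a : C) x : norm (scal a x) = Cmod a * norm x.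
Proof.
apply Rle_antisym; [apply norm_scal_C|].
destruct (Req_dec (Cmod a) 0) as [Ha|Ha].
{ rewrite Ha, Rmult_0_l; apply norm_ge_0. }
assert (a <> 0)%C by (intros ->; apply Ha, Cmod_0).
assert (Hp : 0 < Cmod a) by (apply Cmod_gt_0; easy).
assert (E : x = scal (/ a)%C (scal a x)) by (module_coefs; field; easy).
rewrite E at 1.
apply Rle_trans with (Cmod a * (Cmod (/ a) * norm (scal a x))).
  apply Rmult_le_compat_l; [lra|apply norm_scal_C].
rewrite Cmod_inv by easy; right; field; lra.
Qed.

Lemma norm_minus_sym x y : norm (minus x y) = norm (minus y x).
Proof.
replace (minus x y) with (opp (minus y x)) by module_eq.
apply norm_opp.
Qed.

Lemma norm_minus_le x y : norm (minus x y) <= norm x + norm y.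
Proof. rewrite <- (norm_opp y); apply norm_triangle. Qed.

Lemma norm_triangle_minus x y z :
  norm (minus x z) <= norm (minus x y) + norm (minus y z).
Proof.
replace (minus x z) with (plus (minus x y) (minus y z)) by module_eq.
apply norm_triangle.
Qed.

Lemma norm_le_minus x y : norm x <= norm y + norm (minus x y).
Proof.
replace x with (plus y (minus x y)) at 1 by module_eq.
apply norm_triangle.
Qed.

Lemma sum_n_minus (u v : nat -> X) n :
  sum_n (fun k => minus (u k) (v k)) n = minus (sum_n u n) (sum_n v n).
Proof.
induction n as [|n IH]; [now rewrite !sum_O|].
rewrite !sum_Sn, IH; module_eq.
Qed.

Lemma sum_n_telescope (u : nat -> X) n :
  sum_n (fun k => minus (u (S k)) (u k)) n = minus (u (S n)) (u 0%nat).
Proof.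
induction n as [|n IH]; [now rewrite sum_O|].
rewrite sum_Sn, IH; module_eq.
Qed.

Lemma norm_sum_n_le (u : nat -> X) (v : nat -> R) n :
  (forall k, (k <= n)%nat -> norm (u k) <= v k) ->
  norm (sum_n u n) <= sum_n v n.
Proof.
intros H; induction n as [|n IH].
  rewrite !sum_O; apply H; lia.
rewrite !sum_Sn; eapply Rle_trans; [apply norm_triangle|].
apply Rplus_le_compat; [apply IH; intros; apply H|apply H]; lia.
Qed.

Lemma norm_sum_n_const (u : nat -> X) c n :
  (forall k, (k <= n)%nat -> norm (u k) <= c) ->
  norm (sum_n u n) <= INR (S n) * c.
Proof.
intros H; rewrite <- sum_n_const; now apply norm_sum_n_le.
Qed.

Lemma linear_sum_n (L : X -> X) : is_linear L -> forall (u : nat -> X) n,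
  L (sum_n u n) = sum_n (fun k => L (u k)) n.
Proof.
intros [La _ _] u n; induction n as [|n IH]; [now rewrite !sum_O|].
now rewrite !sum_Sn, La, IH.
Qed.

Lemma linear_scal_C (L : X -> X) : is_linear L -> forall (a : C) x,
  L (scal a x) = scal a (L x).
Proof. intros [_ Ls _] a x; exact (Ls a x). Qed.

Lemma linear_minus_C (L : X -> X) : is_linear L -> forall x y,
  L (minus x y) = minus (L x) (L y).
Proof.
intros HL x y.
replace (minus x y) with (plus x (scal (RtoC (-1)) y)) by module_eq.
rewrite (linear_plus L HL), (linear_scal_C L HL); module_eq.
Qed.

(** Norm convergence as a real limit, which makes squeezing direct. *)
Definition seq_to (u : nat -> X) (l : X) : Prop :=
  is_lim_seq (fun n => norm (minus (u n) l)) 0.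

Lemma seq_to_le (u : nat -> X) l (b : nat -> R) :
  (forall n, norm (minus (u n) l) <= b n) -> is_lim_seq b 0 -> seq_to u l.
Proof.
intros H Hb; apply is_lim_seq_le_le with (fun _ => 0) b; [|apply is_lim_seq_const|easy].
intros n; split; [apply norm_ge_0|apply H].
Qed.

Lemma seq_to_eps (u : nat -> X) l :
  (forall eps : posreal, exists N, forall n, (N <= n)%nat -> norm (minus (u n) l) <= eps) ->
  seq_to u l.
Proof.
intros H; apply is_lim_seq_spec; intros eps.
destruct (H (pos_div_2 eps)) as [N HN]; exists N; intros n Hn.
specialize (HN n Hn); simpl in HN; rewrite Rminus_0_r, Rabs_pos_eq by apply norm_ge_0.
destruct eps as [e He]; simpl in *; lra.
Qed.

Lemma seq_to_ext (u v : nat -> X) l :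
  (forall n, u n = v n) -> seq_to u l -> seq_to v l.
Proof.
intros E; apply is_lim_seq_ext; intros n; now rewrite E.
Qed.

Lemma seq_to_plus (u v : nat -> X) l m :
  seq_to u l -> seq_to v m -> seq_to (fun n => plus (u n) (v n)) (plus l m).
Proof.
intros Hu Hv.
apply seq_to_le with (fun n => norm (minus (u n) l) + norm (minus (v n) m)).
- intros n.
  replace (minus (plus (u n) (v n)) (plus l m))
    with (plus (minus (u n) l) (minus (v n) m)) by module_eq.
  apply norm_triangle.
- replace (Finite 0) with (Finite (0 + 0)) by (f_equal; lra).
  now apply is_lim_seq_plus'.
Qed.

Lemma seq_to_linear (L : X -> X) (u : nat -> X) l :
  is_linear L -> seq_to u l -> seq_to (fun n => L (u n)) (L l).
Proof.
intros HL Hu; pose proof HL as [_ _ [M [HM HLM]]].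
apply seq_to_le with (fun n => M * norm (minus (u n) l)).
- intros n; rewrite <- linear_minus_C by easy; apply HLM.
- replace (Finite 0) with (Rbar_mult M 0) by (simpl; f_equal; ring).
  now apply is_lim_seq_scal_l.
Qed.

Lemma is_linear_scal_C (a : C) : is_linear (fun x : X => scal a x).
Proof.
split.
- intros x y; module_eq.
- intros k x; change (scal a (scal k x) = scal (k : C) (scal a x)); module_eq.
- exists (Cmod a + 1); split; [pose proof (Cmod_ge_0 a); lra|].
  intros x; apply Rle_trans with (1 := norm_scal_C a x); pose proof (norm_ge_0 x); nra.
Qed.

Lemma seq_to_norm_le (u : nat -> X) l (b : nat -> R) (B : R) :
  seq_to u l -> (forall n, norm (u n) <= b n) -> is_lim_seq b B -> norm l <= B.
Proof.
intros Hu Hb HB.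
assert (H : Rbar_le (norm l) (B + 0)); [|simpl in H; lra].
apply is_lim_seq_le with (fun _ => norm l) (fun n => b n + norm (minus (u n) l)).
- intros n; rewrite norm_minus_sym.
  specialize (Hb n); pose proof (norm_le_minus l (u n)); lra.
- apply is_lim_seq_const.
- now apply is_lim_seq_plus'.
Qed.

End Norms.

Lemma seq_to_scal_vec {X : NormedModule C_AbsRing} (c : nat -> C) (x : X) :
  is_lim_seq (fun n => Cmod (c n)) 0 -> seq_to (fun n => scal (c n) x) zero.
Proof.
intros Hc; apply seq_to_le with (fun n => norm x * Cmod (c n)).
- intros n; norm_as (scal (c n) x).
  rewrite norm_scal_eq; lra.
- replace (Finite 0) with (Rbar_mult (norm x) 0) by (simpl; f_equal; ring).
  now apply is_lim_seq_scal_l.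
Qed.

(** * The unit circle *)

Definition cis (t : R) : C := (cos t, sin t).

Lemma cis_plus a b : cis (a + b) = (cis a * cis b)%C.
Proof.
unfold cis, Cmult; simpl; rewrite cos_plus, sin_plus; f_equal; ring.
Qed.

Lemma cis_2PI : cis (2 * PI) = cis 0.
Proof. unfold cis; now rewrite cos_2PI, sin_2PI, cos_0, sin_0. Qed.

Lemma Cmod_sqr_eq (z : C) r : 0 <= r -> Re z ^ 2 + Im z ^ 2 = r ^ 2 -> Cmod z = r.
Proof.
intros Hr H; apply Rsqr_inj; [apply Cmod_ge_0|easy|].
rewrite !Rsqr_pow2, <- H; apply Cmod2_alt.
Qed.

Lemma Cmod_cis t : Cmod (cis t) = 1.
Proof.
apply Cmod_sqr_eq; [lra|]; simpl; pose proof (sin2_cos2 t) as H.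
unfold Rsqr in H; lra.
Qed.

Lemma cis_neq_0 t : cis t <> 0%C.
Proof. intros H; pose proof (Cmod_cis t) as E; rewrite H, Cmod_0 in E; lra. Qed.

Lemma Cmod_Rmult_cis r t : 0 <= r -> Cmod (r * cis t)%C = r.
Proof. intros Hr; rewrite Cmod_mult, Cmod_cis, Cmod_R, Rabs_pos_eq by easy; ring. Qed.

Lemma sin_le_id x : 0 <= x -> sin x <= x.
Proof.
intros [Hx|<-]; [left; now apply sin_lt_x|rewrite sin_0; lra].
Qed.

Lemma sin_ge_cubic x : 0 <= x <= PI -> x - x ^ 3 / 6 <= sin x.
Proof.
intros [H1 H2]; destruct (sin_bound x 0 H1 H2) as [H _].
eapply Rle_trans; [|exact H]; right.
unfold sin_approx, sin_term; simpl; field.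
Qed.

Lemma Rabs_sin_le x : Rabs (sin x) <= Rabs x.
Proof.
assert (P : forall y, 0 <= y -> Rabs (sin y) <= y).
{ intros y Hy; pose proof PI2_1 as HPI; apply Rabs_le; split; [|now apply sin_le_id].
  destruct (Rle_dec y PI) as [H|H]; [|pose proof (SIN_bound y); lra].
  pose proof (sin_ge_0 y Hy H); lra. }
unfold Rabs at 2; destruct (Rcase_abs x) as [H|H]; [|apply P; lra].
rewrite <- Rabs_Ropp, <- sin_neg; apply P; lra.
Qed.

Lemma Cmod_cis_minus a b : Cmod (cis a - cis b)%C <= Rabs (a - b).
Proof.
assert (E : Re (cis a - cis b)%C ^ 2 + Im (cis a - cis b)%C ^ 2
  = (2 * Rabs (sin ((a - b) / 2))) ^ 2).
{ unfold cis, Cminus, Cplus, Copp; simpl.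
  replace (2 * Rabs (sin ((a - b) / 2)) * (2 * Rabs (sin ((a - b) / 2)) * 1))
    with (4 * (Rabs (sin ((a - b) / 2)) * Rabs (sin ((a - b) / 2)))) by ring.
  rewrite <- Rabs_mult, Rabs_pos_eq by apply Rle_0_sqr.
  assert (D : cos (a - b) = 1 - 2 * sin ((a - b) / 2) * sin ((a - b) / 2)).
  { rewrite <- cos_2a_sin; f_equal; field. }
  rewrite cos_minus in D.
  pose proof (sin2_cos2 a) as Ha; pose proof (sin2_cos2 b) as Hb.
  unfold Rsqr in Ha, Hb; nra. }
rewrite (Cmod_sqr_eq _ _ (Rmult_le_pos 2 _ ltac:(lra) (Rabs_pos _)) E).
pose proof (Rabs_sin_le ((a - b) / 2)) as H.
unfold Rdiv in H at 2; rewrite Rabs_mult, (Rabs_pos_eq (/ 2)) in H by lra; lra.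
Qed.

Lemma Cmod_polar_minus (r s a b : R) : 0 <= s ->
  Cmod (r * cis a - s * cis b)%C <= Rabs (r - s) + s * Rabs (a - b).
Proof.
intros Hs.
replace (r * cis a - s * cis b)%C
  with ((r - s)%R * cis a + s * (cis a - cis b))%C by (rewrite RtoC_minus; ring).
eapply Rle_trans; [apply Cmod_triangle|].
rewrite !Cmod_mult, Cmod_cis, !Cmod_R, (Rabs_pos_eq s), Rmult_1_r by easy.
apply Rplus_le_compat_l, Rmult_le_compat_l, Cmod_cis_minus; easy.
Qed.

(** * Resolvents and the discrete Cauchy theorem *)

Definition is_resolvent {X : NormedModule C_AbsRing} (T : X -> X) (z : C)
    (S : X -> X) : Prop :=
  is_linear S /\ (forall x, S (zI_minus z T x) = x) /\
  (forall x, zI_minus z T (S x) = x).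

Section Resolvent.
Context {X : NormedModule C_AbsRing}.
Variable T : X -> X.
Hypothesis HT : is_linear T.
Variable Rz : C -> X -> X.
Implicit Types (a b c z w : C) (x y : X).

Lemma resolvent_eqn z x : is_resolvent T z (Rz z) ->
  scal z (Rz z x) = plus x (T (Rz z x)).
Proof.
intros [_ [_ H2]].
rewrite <- (H2 x) at 2; unfold zI_minus; module_eq.
Qed.

Lemma resolvent_identity a b x : is_resolvent T a (Rz a) -> is_resolvent T b (Rz b) ->
  Rz a x = plus (Rz b x) (scal (b - a)%C (Rz a (Rz b x))).
Proof.
intros [La [Ha1 _]] [_ [_ Hb2]].
set (v := Rz b x).
transitivity (Rz a (plus (zI_minus a T v) (scal (b - a)%C v))).
- f_equal; rewrite <- (Hb2 x); fold v; unfold zI_minus; module_eq.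
- now rewrite (linear_plus _ La), (linear_scal_C _ La), Ha1.
Qed.

Variable x : X.

Definition edge a b : X :=
  scal ((b - a) / 2)%C (plus (Rz a x) (Rz b x)).

Definition triangle a b c : X := plus (edge a b) (plus (edge b c) (edge c a)).

(** Cauchy's theorem for the trapezoidal rule: the resolvent identity makes the
    second divided difference of the resolvent explicit, so the sum around a
    triangle is exactly of third order in its diameter. *)
Lemma triangle_eq a b c :
  is_resolvent T a (Rz a) -> is_resolvent T b (Rz b) -> is_resolvent T c (Rz c) ->
  triangle a b c = scal ((c - a) * (b - c) * (b - a) / 2)%C
    (Rz a (Rz b (Rz c x))).
Proof.
intros Ha Hb Hc; unfold triangle, edge.
pose proof (resolvent_identity a c x Ha Hc) as E1.
pose proof (resolvent_identity b c x Hb Hc) as E2.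
pose proof (resolvent_identity a b (Rz c x) Ha Hb) as E3.
rewrite E1, E2, E3.
module_coefs; field; try (intros H; injection H; lra).
Qed.

Section Bounds.
Variable D : C -> Prop.
Variable B : R.
Hypothesis HB : 0 <= B.
Hypothesis HD : forall z, D z -> is_resolvent T z (Rz z).
Hypothesis HDB : forall z, D z -> forall y, norm (Rz z y) <= B * norm y.

Lemma triangle_le a b c : D a -> D b -> D c ->
  norm (triangle a b c) <= Cmod (c - a) * Cmod (b - c) * Cmod (b - a) * (B ^ 3 * norm x).
Proof.
intros Ha Hb Hc; rewrite triangle_eq by auto; rewrite norm_scal_eq.
unfold Cdiv; rewrite !Cmod_mult.
apply Rmult_le_compat; [|apply norm_ge_0| |].
- repeat apply Rmult_le_pos; apply Cmod_ge_0.
- rewrite <- Rmult_1_r; apply Rmult_le_compat_l.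
  + repeat apply Rmult_le_pos; apply Cmod_ge_0.
  + rewrite Cmod_inv by (intros H; injection H; lra).
    rewrite Cmod_R, Rabs_pos_eq by lra; lra.
- eapply Rle_trans; [apply HDB; auto|].
  replace (B ^ 3 * norm x) with (B * (B * (B * norm x))) by ring.
  apply Rmult_le_compat_l; [easy|].
  eapply Rle_trans; [apply HDB; auto|].
  apply Rmult_le_compat_l; [easy|]; auto.
Qed.

(** Two closed polygons with nearby vertices: the region between them is cut
    into quadrilaterals, each into two triangles, and the sums along the rungs
    cancel because both polygons close up. *)
Lemma polygon_step (p q : nat -> C) n d :
  0 <= d ->
  (forall j, (j <= S n)%nat -> D (p j) /\ D (q j)) ->
  p (S n) = p 0%nat -> q (S n) = q 0%nat ->
  (forall j, (j <= n)%nat -> Cmod (p (S j) - p j) <= d /\ Cmod (q (S j) - q j) <= d) ->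
  (forall j, (j <= S n)%nat -> Cmod (q j - p j) <= d) ->
  norm (minus (sum_n (fun j => edge (p j) (p (S j))) n)
              (sum_n (fun j => edge (q j) (q (S j))) n))
  <= INR (S n) * (4 * d ^ 3 * (B ^ 3 * norm x)).
Proof.
intros Hd HDpq Hp Hq Hstep Hrung.
set (rung := fun j => edge (p j) (q j)).
set (cell := fun j => plus (triangle (p j) (p (S j)) (q (S j)))
                           (triangle (p j) (q (S j)) (q j))).
assert (E : minus (sum_n (fun j => edge (p j) (p (S j))) n)
                  (sum_n (fun j => edge (q j) (q (S j))) n) = sum_n cell n).
{ etransitivity; [symmetry; apply sum_n_minus|].
  transitivity (minus (sum_n cell n) (sum_n (fun j => minus (rung (S j)) (rung j)) n)).
  - etransitivity; [|apply sum_n_minus]; apply sum_n_ext; intros j.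
    unfold cell, rung, triangle, edge; module_coefs; field;
      try (intros H; injection H; lra).
  - rewrite sum_n_telescope; unfold rung; rewrite Hp, Hq; module_eq. }
rewrite E; apply norm_sum_n_const; intros j Hj.
destruct (HDpq j ltac:(lia)) as [D1 D2]; destruct (HDpq (S j) ltac:(lia)) as [D3 D4].
destruct (Hstep j Hj) as [S1 S2].
pose proof (Hrung j ltac:(lia)) as R1; pose proof (Hrung (S j) ltac:(lia)) as R2.
assert (Hdiag : Cmod (q (S j) - p j) <= 2 * d).
{ replace (q (S j) - p j)%C with ((q (S j) - q j) + (q j - p j))%C by ring.
  eapply Rle_trans; [apply Cmod_triangle|lra]. }
assert (Hsym : forall u v : C, Cmod (u - v) = Cmod (v - u)).
{ intros u v; rewrite <- Cmod_opp; f_equal; ring. }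
assert (HK : 0 <= B ^ 3 * norm x).
{ apply Rmult_le_pos; [now apply pow_le|apply norm_ge_0]. }
assert (H3 : forall u v w k : R, (0 <= u <= 2 * d)%R -> 0 <= v <= d -> 0 <= w <= d -> 
   0 <= k -> u * v * w * k <= 2 * d ^ 3 * k).
{ intros u v w k Hu Hv Hw Hk; apply Rmult_le_compat_r; [easy|].
  replace (2 * d ^ 3) with (2 * d * d * d) by ring.
  apply Rmult_le_compat; [apply Rmult_le_pos| |apply Rmult_le_compat|]; lra. }
pose proof Cmod_ge_0 as P0.
eapply Rle_trans; [apply norm_triangle|].
replace (4 * d ^ 3 * (B ^ 3 * norm x))
  with (2 * d ^ 3 * (B ^ 3 * norm x) + 2 * d ^ 3 * (B ^ 3 * norm x)) by ring.
apply Rplus_le_compat; (eapply Rle_trans; [apply triangle_le; easy|]).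
- apply H3; try easy; split; try apply P0; try easy; now rewrite Hsym.
- replace (Cmod (q j - p j) * Cmod (q (S j) - q j) * Cmod (q (S j) - p j))
    with (Cmod (q (S j) - p j) * Cmod (q (S j) - q j) * Cmod (q j - p j)) by ring.
  apply H3; try easy; split; try apply P0; easy.
Qed.

End Bounds.
End Resolvent.

(** * Riemann sums of the resolvent along a star-shaped curve *)

(** There are [n + 1] nodes, so that no positivity condition on the number of nodes
    is ever needed. *)
Definition ang (n j : nat) : R := 2 * PI * INR j / INR (S n).

Definition curve (rho : R -> R) (t : R) : C := (rho t * cis t)%C.

Lemma INR_S_pos n : 0 < INR (S n).
Proof. apply lt_0_INR; lia. Qed.

Lemma ang_range n j : (j <= S n)%nat -> 0 <= ang n j <= 2 * PI.
Proof.
intros H; apply le_INR in H; pose proof (INR_S_pos n) as P; pose proof (pos_INR j).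
pose proof PI_RGT_0; unfold ang; split.
- apply Rdiv_le_0_compat; [|easy]; apply Rmult_le_pos; lra.
- apply Rle_div_l; [easy|]; apply Rmult_le_compat_l; lra.
Qed.

Lemma ang_S n j : ang n (S j) = ang n j + 2 * PI / INR (S n).
Proof.
unfold ang; rewrite (S_INR j); field; apply Rgt_not_eq, INR_S_pos.
Qed.

Lemma ang_0 n : ang n 0 = 0.
Proof. unfold ang; simpl INR at 1; field; apply Rgt_not_eq, INR_S_pos. Qed.

Lemma ang_last n : ang n (S n) = 2 * PI.
Proof. unfold ang; field; apply Rgt_not_eq, INR_S_pos. Qed.

Lemma sin_ge_cubic_all x : 0 <= x -> x - x ^ 3 / 6 <= sin x.
Proof.
intros Hx; destruct (Rle_dec x PI) as [H|H]; [now apply sin_ge_cubic|].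
pose proof PI2_3_2; pose proof (SIN_bound x) as [S1 _].
assert (3 <= x) by lra.
assert (9 <= x * x) by nra.
assert (x * (x * x - 6) >= 3 * 3) by nra.
lra.
Qed.

(** The hypotheses on the radius function of a closed curve around [0] that
    make its Riemann sums converge. *)
Record radial_curve (rho : R -> R) (M L : R) : Prop := {
  rc_pos : forall t, 0 <= t <= 2 * PI -> 0 <= rho t <= M;
  rc_lip : forall t u, 0 <= t <= 2 * PI -> 0 <= u <= 2 * PI ->
           Rabs (rho t - rho u) <= L * Rabs (t - u);
  rc_closed : rho (2 * PI) = rho 0 }.

Lemma radial_curve_step rho M L n j : radial_curve rho M L -> (j <= n)%nat ->
  Cmod (curve rho (ang n (S j)) - curve rho (ang n j)) <=
  (L + M) * (2 * PI / INR (S n)).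
Proof.
intros [Hpos Hlip _] Hj; unfold curve.
pose proof (ang_range n j ltac:(lia)) as A1; pose proof (ang_range n (S j) ltac:(lia)) as A2.
destruct (Hpos _ A1) as [P1 P2].
assert (E : Rabs (ang n (S j) - ang n j) = 2 * PI / INR (S n)).
{ rewrite ang_S; replace (_ + _ - _) with (2 * PI / INR (S n)) by ring.
  apply Rabs_pos_eq, Rdiv_le_0_compat; [pose proof PI_RGT_0; lra|apply INR_S_pos]. }
eapply Rle_trans; [now apply Cmod_polar_minus|].
pose proof (Hlip _ _ A2 A1) as H; rewrite E in H |- *.
assert (0 <= 2 * PI / INR (S n)) by (rewrite <- E; apply Rabs_pos).
nra.
Qed.

Lemma radial_curve_closed rho M L n : radial_curve rho M L ->
  curve rho (ang n (S n)) = curve rho (ang n 0).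
Proof.
intros [_ _ Hc]; unfold curve; rewrite ang_last, ang_0, cis_2PI; congruence.
Qed.

(** Radius along the straight-line homotopy from the curve ([u = 0]) to the circle
    of radius [r] ([u = 1]); all its stages lie outside the curve, where the resolvent
    is bounded. *)
Definition blend (rho : R -> R) (r u t : R) : R := rho t + u * (r - rho t).

Lemma radial_curve_blend rho M L r u :
  radial_curve rho M L -> 0 <= L -> M <= r -> 0 <= u <= 1 ->
  radial_curve (blend rho r u) r L.
Proof.
intros [Hpos Hlip Hc] HL Hr Hu; unfold blend; split.
- intros t Ht; specialize (Hpos t Ht); nra.
- intros t v Ht Hv.
  replace (_ - _) with ((1 - u) * (rho t - rho v)) by ring.
  rewrite Rabs_mult, (Rabs_pos_eq (1 - u)) by lra.
  specialize (Hlip t v Ht Hv); pose proof (Rabs_pos (rho t - rho v)); nra.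
- now rewrite Hc.
Qed.

Section Cauchy.
Context {X : NormedModule C_AbsRing}.
Variable T : X -> X.
Hypothesis HT : is_linear T.
Variable Rz : C -> X -> X.
Variables (rho : R -> R) (M L B : R).
Hypothesis Hrho : radial_curve rho M L.
Hypothesis HL : 0 <= L.
Hypothesis HB : 0 <= B.
Definition outside (z : C) : Prop :=
  exists t r, 0 <= t <= 2 * PI /\ rho t <= r /\ z = (r * cis t)%C.
Hypothesis HD : forall z, outside z -> is_resolvent T z (Rz z).
Hypothesis HDB : forall z, outside z -> forall y, norm (Rz z y) <= B * norm y.

Definition left_sum (n : nat) (f : C -> X) : X :=
  sum_n (fun j => scal (curve rho (ang n (S j)) - curve rho (ang n j))%C
                       (f (curve rho (ang n j)))) n.

Lemma outside_blend n j r u : M <= r -> 0 <= u -> (j <= S n)%nat ->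
  outside (curve (blend rho r u) (ang n j)).
Proof.
intros Hr Hu Hj; exists (ang n j), (blend rho r u (ang n j)).
pose proof (ang_range n j Hj) as A; split; [easy|split; [|easy]].
unfold blend; pose proof (rc_pos _ _ _ Hrho _ A); nra.
Qed.

Lemma curve_blend_0 r t : curve (blend rho r 0) t = curve rho t.
Proof. unfold curve, blend; do 3 f_equal; ring. Qed.

Lemma outside_curve n j : (j <= S n)%nat -> outside (curve rho (ang n j)).
Proof.
intros Hj; rewrite <- (curve_blend_0 M).
apply outside_blend; [apply Rle_refl|lra|easy].
Qed.

Variable x : X.

Definition polygon_sum r n u : X :=
  sum_n (fun j => edge Rz x (curve (blend rho r u) (ang n j))
                            (curve (blend rho r u) (ang n (S j)))) n.

Definition mesh r n : R := (L + r) * (2 * PI / INR (S n)).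

Lemma mesh_ge_0 r n : M <= r -> 0 <= mesh r n.
Proof.
intros Hr; pose proof (rc_pos _ _ _ Hrho 0); pose proof PI_RGT_0.
apply Rmult_le_pos; [lra|apply Rdiv_le_0_compat; [lra|apply INR_S_pos]].
Qed.

(** As many intermediate curves as nodes: there are [(n + 1)^2] quadrilaterals, each with
    an error of third order in the mesh, so the total error is [O(1 / n)]. *)
Lemma polygon_sum_homotopy r n : M <= r ->
  norm (minus (polygon_sum r n 0) (polygon_sum r n 1)) <=
  INR (S n) * INR (S n) * (4 * mesh r n ^ 3 * (B ^ 3 * norm x)).
Proof.
intros Hr.
assert (HP := INR_S_pos n).
assert (Hm := mesh_ge_0 r n Hr).
assert (HM : 0 <= M) by (pose proof (rc_pos _ _ _ Hrho 0); pose proof PI_RGT_0; lra).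
set (K := 4 * mesh r n ^ 3 * (B ^ 3 * norm x)).
assert (G : forall i, (i <= S n)%nat ->
  norm (minus (polygon_sum r n 0) (polygon_sum r n (INR i / INR (S n)))) <=
  INR i * (INR (S n) * K)).
{ induction i as [|i IH]; intros Hi.
  - simpl (INR 0); unfold Rdiv; rewrite !Rmult_0_l.
    replace (minus (polygon_sum r n 0) (polygon_sum r n 0)) with (zero : X) by module_eq.
    rewrite norm_zero; lra.
  - eapply Rle_trans; [apply (norm_triangle_minus _ (polygon_sum r n (INR i / INR (S n))))|].
    specialize (IH ltac:(lia)).
    replace (INR (S i) * (INR (S n) * K)) with (INR i * (INR (S n) * K) + INR (S n) * K)
      by (rewrite (S_INR i); ring).
    apply Rplus_le_compat; [easy|].
    assert (U : forall k, (k <= S n)%nat -> 0 <= INR k / INR (S n) <= 1).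
    { intros k Hk; apply le_INR in Hk; pose proof (pos_INR k); split.
      - now apply Rdiv_le_0_compat.
      - apply Rle_div_l; lra. }
    assert (Ui := U i ltac:(lia)); assert (Us := U (S i) Hi).
    assert (C1 := radial_curve_blend _ _ _ r _ Hrho HL Hr Ui).
    assert (C2 := radial_curve_blend _ _ _ r _ Hrho HL Hr Us).
    unfold polygon_sum.
    apply (polygon_step T Rz x outside B HB HD HDB
      (fun j => curve (blend rho r (INR i / INR (S n))) (ang n j))
      (fun j => curve (blend rho r (INR (S i) / INR (S n))) (ang n j))); try easy.
    + intros j Hj; split; apply outside_blend; easy.
    + now apply radial_curve_closed with r L.
    + now apply radial_curve_closed with r L.
    + intros j Hj; split; now apply radial_curve_step.
    + intros j Hj; unfold curve.
      replace (blend rho r (INR (S i) / INR (S n)) (ang n j) * cis (ang n j) -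
        blend rho r (INR i / INR (S n)) (ang n j) * cis (ang n j))%C
        with ((blend rho r (INR (S i) / INR (S n)) (ang n j)
               - blend rho r (INR i / INR (S n)) (ang n j))%R * cis (ang n j))%C
        by (rewrite RtoC_minus; ring).
      unfold blend.
      replace (_ - _) with ((r - rho (ang n j)) * / INR (S n))
        by (rewrite (S_INR i); field; lra).
      pose proof (rc_pos _ _ _ Hrho _ (ang_range n j Hj)) as Q.
      pose proof (Rinv_0_lt_compat _ HP) as V.
      rewrite Cmod_Rmult_cis by (apply Rmult_le_pos; lra).
      unfold mesh, Rdiv; rewrite <- Rmult_assoc.
      apply Rmult_le_compat_r; [lra|].
      pose proof PI2_3_2; nra. }
specialize (G (S n) (Nat.le_refl _)).
replace (INR (S n) / INR (S n)) with 1 in G by (field; lra).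
rewrite Rmult_assoc; exact G.
Qed.

(** The resolvent equation gives [R(z) x - x / z = T R(z) x / z], and absorbing the
    last term for large [z] bounds [R(z) x] by [2 |x| / |z|]. *)
Lemma resolvent_far z KT : outside z -> 0 <= KT ->
  (forall y, norm (T y) <= KT * norm y) -> 0 < Cmod z -> 2 * KT <= Cmod z ->
  norm (minus (Rz z x) (scal (/ z)%C x)) <= 2 * KT * norm x / Cmod z ^ 2.
Proof.
intros Hz HK HTK Hz0 HzK.
assert (z <> 0)%C by now apply Cmod_gt_0.
pose proof (resolvent_eqn T Rz z x (HD z Hz)) as E.
assert (E2 : minus (Rz z x) (scal (/ z)%C x) = scal (/ z)%C (T (Rz z x))).
{ replace (Rz z x) with (scal (/ z)%C (scal z (Rz z x))) at 1
    by (module_coefs; field; easy).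
  rewrite E; module_eq. }
rewrite E2, norm_scal_eq, Cmod_inv by easy.
assert (N1 : Cmod z * norm (Rz z x) <= 2 * norm x).
{ rewrite <- norm_scal_eq, E.
  assert (norm (T (Rz z x)) <= norm (scal z (Rz z x)) / 2).
  { eapply Rle_trans; [apply HTK|]; rewrite norm_scal_eq.
    pose proof (norm_ge_0 (Rz z x)); nra. }
  rewrite E in H0; pose proof (norm_triangle x (T (Rz z x))); lra. }
specialize (HTK (Rz z x)).
apply Rmult_le_reg_l with (Cmod z ^ 2); [nra|].
replace (Cmod z ^ 2 * (/ Cmod z * norm (T (Rz z x)))) with (Cmod z * norm (T (Rz z x)))
  by (field; lra).
replace (Cmod z ^ 2 * (2 * KT * norm x / Cmod z ^ 2)) with (KT * (2 * norm x))
  by (field; lra).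
nra.
Qed.

(** For the function [1 / z] the trapezoidal rule on an arc of angle [h] is exactly
    [i sin h], whatever the radius. *)
Lemma edge_circle r t h KT : M <= r -> 0 < r -> 0 <= h -> 
  0 <= t <= 2 * PI -> 0 <= t + h <= 2 * PI -> 0 <= KT ->
  (forall y, norm (T y) <= KT * norm y) -> 2 * KT <= r ->
  norm (minus (edge Rz x (r * cis t)%C (r * cis (t + h))%C) (scal (Ci * sin h)%C x))
  <= h * (2 * KT * norm x / r).
Proof.
intros HMr Hr Hh Ht Hth HK HTK HKr.
set (a := (r * cis t)%C); set (b := (r * cis (t + h))%C).
assert (Fa : forall s, 0 <= s <= 2 * PI ->
  norm (minus (Rz (r * cis s)%C x) (scal (/ (r * cis s))%C x)) <= 2 * KT * norm x / r ^ 2).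
{ intros s Hs.
  pose proof (Cmod_Rmult_cis r s ltac:(lra)) as Em.
  pose proof (resolvent_far (r * cis s)%C KT) as Q; rewrite Em in Q.
  apply Q; try easy.
  exists s, r; split; [easy|split; [|easy]].
  pose proof (rc_pos _ _ _ Hrho _ Hs); lra. }
assert (Na : a <> 0%C).
{ apply Cmod_gt_0; unfold a; rewrite Cmod_Rmult_cis; lra. }
assert (Nb : b <> 0%C).
{ apply Cmod_gt_0; unfold b; rewrite Cmod_Rmult_cis; lra. }
assert (Es : (Ci * sin h)%C = ((b - a) / 2 * (/ a + / b))%C).
{ assert (Nh : cis h <> 0%C) by apply cis_neq_0.
  assert (Eh : (cis h - / cis h)%C = (2 * (Ci * sin h))%C).
  { replace (/ cis h)%C with (cis (- h)).
    - unfold cis; rewrite cos_neg, sin_neg.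
      unfold Ci, RtoC, Cmult, Cminus, Cplus, Copp; simpl; f_equal; ring.
    - assert (Ei : (cis h * cis (- h))%C = 1%C).
      { rewrite <- cis_plus, Rplus_opp_r; unfold cis; now rewrite cos_0, sin_0. }
      rewrite <- (Cmult_1_l (/ cis h)), <- Ei; field; easy. }
  assert (Eb : b = (a * cis h)%C) by (unfold a, b; rewrite cis_plus; ring).
  rewrite Eb; replace ((a * cis h - a) / 2 * (/ a + / (a * cis h)))%C
    with ((cis h - / cis h) / 2)%C by (field; split; easy).
  rewrite Eh; field; intros H; injection H; lra. }
rewrite Es; unfold edge.
norm_as (scal ((b - a) / 2)%C (plus (minus (Rz a x) (scal (/ a)%C x))
                                    (minus (Rz b x) (scal (/ b)%C x)))).
rewrite norm_scal_eq.
assert (Hba : Cmod ((b - a) / 2)%C <= r * h / 2).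
{ unfold Cdiv; rewrite Cmod_mult, Cmod_inv by (intros H; injection H; lra).
  rewrite Cmod_R, (Rabs_pos_eq 2) by lra.
  apply Rmult_le_compat_r; [lra|]; unfold a, b.
  eapply Rle_trans; [apply Cmod_polar_minus; lra|].
  replace (t + h - t) with h by ring.
  rewrite Rminus_diag, Rabs_R0, (Rabs_pos_eq h) by lra; lra. }
replace (h * (2 * KT * norm x / r))
  with (r * h / 2 * (2 * KT * norm x / r ^ 2 + 2 * KT * norm x / r ^ 2)) by (field; lra).
apply Rmult_le_compat; [apply Cmod_ge_0|apply norm_ge_0|easy|].
eapply Rle_trans; [apply norm_triangle|].
apply Rplus_le_compat; now apply Fa.
Qed.

Lemma polygon_sum_circle r n KT : M <= r -> 0 < r -> 0 <= KT ->
  (forall y, norm (T y) <= KT * norm y) -> 2 * KT <= r ->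
  norm (minus (polygon_sum r n 1) (scal (2 * PI * Ci)%C x)) <=
  4 * PI * KT * norm x / r + (2 * PI) ^ 3 / 6 * norm x / INR (S n).
Proof.
intros HMr Hr HK HTK HKr.
pose proof (INR_S_pos n) as HP; pose proof PI_RGT_0 as HPI.
assert (H1 : 1 <= INR (S n)) by (apply (le_INR 1); lia).
set (h := 2 * PI / INR (S n)).
assert (Hh : 0 <= h) by (apply Rdiv_le_0_compat; lra).
assert (Hs : sum_n (fun _ => scal (Ci * sin h)%C x) n = scal (INR (S n) * (Ci * sin h))%C x).
{ generalize (Ci * sin h)%C as c; clear; intros c; induction n as [|n IH].
  - rewrite sum_O; simpl; module_eq.
  - rewrite sum_Sn, IH, (S_INR (S n)), RtoC_plus; module_eq. }
eapply Rle_trans; [apply (norm_triangle_minus _ (sum_n (fun _ => scal (Ci * sin h)%C x) n))|].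
apply Rplus_le_compat.
- refine (Rle_trans _ _ _ (Req_le _ _ (f_equal norm (eq_sym (sum_n_minus _ _ n)))) _).
  replace (4 * PI * KT * norm x / r) with (INR (S n) * (h * (2 * KT * norm x / r)))
    by (unfold h; field; lra).
  apply norm_sum_n_const; intros j Hj.
  assert (E : forall t, curve (blend rho r 1) t = (r * cis t)%C).
  { intros t; unfold curve, blend; do 2 f_equal; ring. }
  rewrite !E.
  pose proof (ang_range n (S j) ltac:(lia)) as A; rewrite ang_S in A |- *; fold h in A |- *.
  apply edge_circle; try easy; apply ang_range; lia.
- rewrite Hs.
  norm_as (scal ((INR (S n) * sin h - 2 * PI) * Ci)%C x).
  rewrite <- !RtoC_mult, <- RtoC_minus.
  rewrite norm_scal_eq, Cmod_mult, Cmod_Ci, Cmod_R.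
  replace ((2 * PI) ^ 3 / 6 * norm x / INR (S n))
    with ((2 * PI) ^ 3 / 6 / INR (S n) * 1 * norm x) by (field; lra).
  apply Rmult_le_compat_r; [apply norm_ge_0|].
  apply Rmult_le_compat_r; [lra|].
  replace (2 * PI) with (INR (S n) * h) at 1 by (unfold h; field; lra).
  replace (_ - _) with (- (INR (S n) * (h - sin h))) by ring.
  pose proof (sin_le_id h Hh); pose proof (sin_ge_cubic_all h Hh).
  rewrite Rabs_Ropp, Rabs_pos_eq by (apply Rmult_le_pos; lra).
  apply Rle_trans with (INR (S n) * (h ^ 3 / 6)); [apply Rmult_le_compat_l; lra|].
  replace ((2 * PI) ^ 3 / 6 / INR (S n)) with (INR (S n) * (INR (S n) * (h ^ 3 / 6)))
    by (unfold h; field; lra).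
  assert (0 <= h ^ 3) by now apply pow_le.
  apply Rmult_le_compat_l; [lra|].
  rewrite <- (Rmult_1_l (h ^ 3 / 6)) at 1; apply Rmult_le_compat_r; lra.
Qed.

(** The trapezoidal rule serves the third-order cancellation only; once the curve is
    fixed, left endpoints are as good and suit the later estimates. *)
Lemma left_sum_polygon r n : M <= r ->
  norm (minus (left_sum n (fun z => Rz z x)) (polygon_sum r n 0)) <=
  INR (S n) * (mesh r n ^ 2 * (B ^ 2 * norm x)).
Proof.
intros Hr; unfold left_sum, polygon_sum.
refine (Rle_trans _ _ _ (Req_le _ _ (f_equal norm (eq_sym (sum_n_minus _ _ n)))) _).
apply norm_sum_n_const; intros j Hj; rewrite !curve_blend_0.
pose proof (outside_curve n j ltac:(lia)) as Ha.
pose proof (outside_curve n (S j) ltac:(lia)) as Hb.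
pose proof (radial_curve_step _ _ _ n j Hrho Hj) as Hs.
set (a := curve rho (ang n j)) in *; set (b := curve rho (ang n (S j))) in *.
pose proof (resolvent_identity T Rz a b x (HD a Ha) (HD b Hb)) as E.
assert (Hm : Cmod (b - a) <= mesh r n).
{ eapply Rle_trans; [exact Hs|]; apply Rmult_le_compat_r; [|lra].
  pose proof PI_RGT_0; apply Rdiv_le_0_compat; [lra|apply INR_S_pos]. }
unfold edge; rewrite E.
replace (minus _ _) with (scal ((b - a) * (b - a) / 2)%C (Rz a (Rz b x)))
  by (module_coefs; field; intros H; injection H; lra).
rewrite norm_scal_eq; unfold Cdiv.
rewrite !Cmod_mult, Cmod_inv by (intros H; injection H; lra).
rewrite Cmod_R, (Rabs_pos_eq 2) by lra.
apply Rmult_le_compat; [|apply norm_ge_0| |].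
- repeat apply Rmult_le_pos; try apply Cmod_ge_0; lra.
- pose proof (Cmod_ge_0 (b - a)); nra.
- eapply Rle_trans; [apply HDB; auto|].
  replace (B ^ 2 * norm x) with (B * (B * norm x)) by ring.
  apply Rmult_le_compat_l; [easy|]; auto.
Qed.

(** The homotopy error vanishes as the mesh is refined for a fixed circle; the
    error on the circle is [O(1/r)], while the left-hand side does not depend
    on [r]. *)
Lemma cauchy_resolvent :
  seq_to (fun n => left_sum n (fun z => Rz z x)) (scal (2 * PI * Ci)%C x).
Proof.
destruct HT as [_ _ [KT [HKT HTK]]].
pose proof PI_RGT_0 as HPI; pose proof (norm_ge_0 x) as Hx.
apply seq_to_eps; intros [eps Heps]; simpl.
set (Q := 4 * PI * KT * norm x).
assert (HQ : 0 <= Q) by (apply Rmult_le_pos; [apply Rmult_le_pos; lra|easy]).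
(* The last entry makes the error on the circle at most [eps / 2]. *)
set (r := Rmax (Rmax 1 M) (Rmax (2 * KT) (2 * Q / eps))).
assert (r >= 1 /\ M <= r /\ 2 * KT <= r /\ 2 * Q / eps <= r) as [Hr1 [HMr [HKr HQr]]].
{ unfold r; pose proof (Rmax_l (Rmax 1 M) (Rmax (2 * KT) (2 * Q / eps))).
  pose proof (Rmax_r (Rmax 1 M) (Rmax (2 * KT) (2 * Q / eps))).
  pose proof (Rmax_l 1 M); pose proof (Rmax_r 1 M).
  pose proof (Rmax_l (2 * KT) (2 * Q / eps)); pose proof (Rmax_r (2 * KT) (2 * Q / eps)).
  lra. }
set (K := ((L + r) * (2 * PI)) ^ 2 * (B ^ 2 * norm x)
        + 4 * ((L + r) * (2 * PI)) ^ 3 * (B ^ 3 * norm x) + (2 * PI) ^ 3 / 6 * norm x).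
assert (Hbound : forall n,
  norm (minus (left_sum n (fun z => Rz z x)) (scal (2 * PI * Ci)%C x)) <=
  K / INR (S n) + Q / r).
{ intros n; pose proof (INR_S_pos n).
  eapply Rle_trans; [apply (norm_triangle_minus _ (polygon_sum r n 0))|].
  eapply Rle_trans; [apply Rplus_le_compat_l, (norm_triangle_minus _ (polygon_sum r n 1))|].
  pose proof (left_sum_polygon r n HMr) as H1.
  pose proof (polygon_sum_homotopy r n HMr) as H2.
  pose proof (polygon_sum_circle r n KT HMr ltac:(lra) ltac:(lra) HTK HKr) as H3.
  replace (INR (S n) * (mesh r n ^ 2 * (B ^ 2 * norm x)))
    with (((L + r) * (2 * PI)) ^ 2 * (B ^ 2 * norm x) / INR (S n)) in H1
    by (unfold mesh; field; lra).
  replace (INR (S n) * INR (S n) * (4 * mesh r n ^ 3 * (B ^ 3 * norm x)))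
    with (4 * ((L + r) * (2 * PI)) ^ 3 * (B ^ 3 * norm x) / INR (S n)) in H2
    by (unfold mesh; field; lra).
  fold Q in H3.
  unfold K; rewrite !Rdiv_plus_distr; lra. }
assert (HQ2 : Q / r <= eps / 2).
{ apply Rle_div_l in HQr; [|easy]; apply Rle_div_l; [lra|]; nra. }
destruct (nfloor_ex (Rmax 0 (2 * K / eps)) (Rmax_l _ _)) as [N [_ HN]].
exists N; intros n Hn; eapply Rle_trans; [apply Hbound|].
assert (K / INR (S n) <= eps / 2); [|lra].
pose proof (INR_S_pos n); apply Rle_div_l; [easy|].
apply le_INR in Hn; rewrite (S_INR n).
pose proof (Rmax_r 0 (2 * K / eps)) as H1.
assert (H2 : 2 * K / eps <= INR n + 1) by lra.
apply Rle_div_l in H2; [|easy]; lra.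
Qed.

End Cauchy.

(** * The Cauchy formula for polynomials *)

(** First-order Taylor bound for the primitive [z^(k+1)] of [(k+1) z^k], uniform on a
    disc: the local error of a Riemann sum of powers. *)
Lemma Cpow_taylor (M : R) (k : nat) : 0 <= M -> exists K, 0 <= K /\
  forall a b : C, Cmod a <= M -> Cmod b <= M ->
  Cmod (b ^ S k - a ^ S k - INR (S k) * (b - a) * a ^ k)%C <= K * Cmod (b - a) ^ 2.
Proof.
intros HM; induction k as [|k [K [HK IH]]].
- exists 0; split; [lra|]; intros a b _ _.
  replace (b ^ 1 - a ^ 1 - INR 1 * (b - a) * a ^ 0)%C with (RtoC 0)
    by (simpl; ring).
  rewrite Cmod_0; lra.
- exists (M * K + INR (S k) * M ^ k); split.
  { apply Rplus_le_le_0_compat; apply Rmult_le_pos; try easy.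
    - apply pos_INR.
    - now apply pow_le. }
  intros a b Ha Hb.
  replace (b ^ S (S k) - a ^ S (S k) - INR (S (S k)) * (b - a) * a ^ S k)%C
    with (b * (b ^ S k - a ^ S k - INR (S k) * (b - a) * a ^ k)
          + INR (S k) * a ^ k * (b - a) ^ 2)%C
    by (rewrite (S_INR (S k)), RtoC_plus, (Cpow_S b (S k)), (Cpow_S a (S k)), (Cpow_S a k);
        simpl; ring).
  eapply Rle_trans; [apply Cmod_triangle|].
  rewrite !Cmod_mult, Cmod_R, (Rabs_pos_eq (INR (S k))) by apply pos_INR.
  rewrite !Cmod_pow, Rmult_plus_distr_r.
  specialize (IH a b Ha Hb); pose proof (Cmod_ge_0 a); pose proof (Cmod_ge_0 b).
  apply Rplus_le_compat.
  + rewrite Rmult_assoc; apply Rmult_le_compat; try easy; apply Cmod_ge_0.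
  + apply Rmult_le_compat_r; [apply pow_le, Cmod_ge_0|].
    apply Rmult_le_compat_l; [apply pos_INR|]; now apply pow_incr.
Qed.

Lemma is_lim_seq_div_INR (K : R) : is_lim_seq (fun n => K / INR (S n)) 0.
Proof.
replace (Finite 0) with (Rbar_mult K 0) by (simpl; f_equal; ring).
apply is_lim_seq_scal_l.
replace (Finite 0) with (Rbar_inv p_infty) by easy.
apply is_lim_seq_inv; [|easy].
apply -> is_lim_seq_incr_1; apply is_lim_seq_INR.
Qed.

(** The codomain is written as a normed module so that Riemann sums of scalar functions
    are an instance of [left_sum]. *)
Definition pow_fun (k : nat) (z : C) : C_NormedModule := (z ^ k)%C.

(** A power of [z] has a primitive, so its Riemann sums along a closed curve
    tend to [0]. *)
Lemma left_sum_power rho M L k : radial_curve rho M L -> 0 <= L ->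
  is_lim_seq (fun n => Cmod (left_sum rho n (pow_fun k))) 0.
Proof.
intros Hrho HL; pose proof PI_RGT_0 as HPI.
assert (HM : 0 <= M) by (pose proof (rc_pos _ _ _ Hrho 0); lra).
destruct (Cpow_taylor M k HM) as [K [HK HT]].
apply is_lim_seq_le_le with (fun _ => 0)
  (fun n => K * ((L + M) * (2 * PI)) ^ 2 / INR (S n));
  [|apply is_lim_seq_const|apply is_lim_seq_div_INR].
intros n; split; [apply Cmod_ge_0|].
pose proof (INR_S_pos n) as Hn; pose proof (INR_S_pos k) as Hk.
set (z := fun j => curve rho (ang n j)).
assert (Hz : forall j, (j <= S n)%nat -> Cmod (z j) <= M).
{ intros j Hj; pose proof (rc_pos _ _ _ Hrho _ (ang_range n j Hj)).
  unfold z, curve; rewrite Cmod_Rmult_cis; lra. }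
set (err := fun j => (z (S j) ^ S k - z j ^ S k - INR (S k) * (z (S j) - z j) * z j ^ k)%C
  : C_NormedModule).
assert (E : scal (RtoC (INR (S k))) (left_sum rho n (pow_fun k)) = opp (sum_n err n)).
{ assert (G : minus (sum_n (fun j => minus (pow_fun (S k) (z (S j))) (pow_fun (S k) (z j))) n)
            (scal (RtoC (INR (S k))) (left_sum rho n (pow_fun k))) = sum_n err n).
  { unfold left_sum; etransitivity.
    { apply f_equal; symmetry; exact (sum_n_scal_l (RtoC (INR (S k)) : C_AbsRing) _ n). }
    etransitivity; [symmetry; apply (sum_n_minus (X := C_NormedModule))|].
    apply sum_n_ext; intros j; unfold err, pow_fun, z.
    set (b := curve rho (ang n (S j))); set (a := curve rho (ang n j)).
    change ((b ^ S k - a ^ S k - INR (S k) * ((b - a) * a ^ k))%C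
      = (b ^ S k - a ^ S k - INR (S k) * (b - a) * a ^ k)%C); ring. }
  rewrite <- G, (sum_n_telescope (X := C_NormedModule) (fun j => pow_fun (S k) (z j))).
  unfold z; rewrite (radial_curve_closed rho M L n Hrho).
  set (u := scal _ _); module_eq. }
assert (E2 : INR (S k) * Cmod (left_sum rho n (pow_fun k)) <=
  INR (S n) * (K * ((L + M) * (2 * PI / INR (S n))) ^ 2)).
{ rewrite <- (Rabs_pos_eq (INR (S k))) at 1 by lra; rewrite <- Cmod_R, <- Cmod_mult.
  change (norm (scal (RtoC (INR (S k))) (left_sum rho n (pow_fun k)) : C_NormedModule) <=
    INR (S n) * (K * ((L + M) * (2 * PI / INR (S n))) ^ 2)).
  rewrite E, norm_opp; apply norm_sum_n_const; intros j Hj.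
  eapply Rle_trans; [apply HT; apply Hz; lia|].
  apply Rmult_le_compat_l; [easy|]; apply pow_incr; split; [apply Cmod_ge_0|].
  now apply radial_curve_step. }
replace (K * ((L + M) * (2 * PI)) ^ 2 / INR (S n))
  with (INR (S n) * (K * ((L + M) * (2 * PI / INR (S n))) ^ 2)) by (field; lra).
assert (1 <= INR (S k)) by (apply (le_INR 1); lia).
pose proof (Cmod_ge_0 (left_sum rho n (pow_fun k))); nra.
Qed.

Lemma scal_sum_n {X : NormedModule C_AbsRing} (u : nat -> C_NormedModule) n (x : X) :
  scal (sum_n u n : C) x = sum_n (fun j => scal (u j : C) x) n.
Proof.
induction n as [|n IH]; [now rewrite !sum_O|].
rewrite !sum_Sn, <- IH; exact (scal_distr_r (K := C_AbsRing) _ _ x).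
Qed.

Section CauchyPolynomial.
Context {X : NormedModule C_AbsRing}.
Variable T : X -> X.
Hypothesis HT : is_linear T.
Variable Rz : C -> X -> X.
Variables (rho : R -> R) (M L B : R).
Hypothesis Hrho : radial_curve rho M L.
Hypothesis HL : 0 <= L.
Hypothesis HB : 0 <= B.
Hypothesis HD : forall z, outside rho z -> is_resolvent T z (Rz z).
Hypothesis HDB : forall z, outside rho z -> forall y, norm (Rz z y) <= B * norm y.
Variable x : X.

(** Functional calculus by the Cauchy integral: [F] of [T] sends [x] to [y]. *)
Definition cauchy_value (F : C -> C) (y : X) : Prop :=
  seq_to (fun n => left_sum rho n (fun z => scal (F z) (Rz z x)))
         (scal (2 * PI * Ci)%C y).

Lemma cauchy_value_ext F G y : (forall z, F z = G z) ->
  cauchy_value F y -> cauchy_value G y.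
Proof.
intros E; apply seq_to_ext; intros n; apply sum_n_ext; intros j; now rewrite E.
Qed.

Lemma cauchy_value_plus F G y y' : cauchy_value F y -> cauchy_value G y' ->
  cauchy_value (fun z => F z + G z)%C (plus y y').
Proof.
intros HF HG; unfold cauchy_value.
replace (scal (2 * PI * Ci)%C (plus y y'))
  with (plus (scal (2 * PI * Ci)%C y) (scal (2 * PI * Ci)%C y')) by module_eq.
eapply seq_to_ext; [|exact (seq_to_plus _ _ _ _ HF HG)].
intros n; unfold left_sum; etransitivity; [symmetry; apply sum_n_plus|].
apply sum_n_ext; intros j; module_eq.
Qed.

Lemma cauchy_value_scal (a : C) F y : cauchy_value F y ->
  cauchy_value (fun z => a * F z)%C (scal a y).
Proof.
intros HF; unfold cauchy_value.
replace (scal (2 * PI * Ci)%C (scal a y)) with (scal a (scal (2 * PI * Ci)%C y))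
  by module_eq.
eapply seq_to_ext; [|exact (seq_to_linear _ _ _ (is_linear_scal_C a) HF)].
intros n; unfold left_sum; etransitivity; [symmetry; exact (sum_n_scal_l (a : C_AbsRing) _ n)|].
apply sum_n_ext; intros j; cbv beta.
change (@scal C_AbsRing X) with (@scal C_Ring X); module_eq.
Qed.

(** The resolvent equation [z R(z) = 1 + T R(z)] turns a factor [z] into a
    factor [T], up to a Riemann sum of a power. *)
Lemma cauchy_value_power k : cauchy_value (fun z => z ^ k)%C (Nat.iter k T x).
Proof.
induction k as [|k IH].
- eapply seq_to_ext; [|exact (cauchy_resolvent T HT Rz rho M L B Hrho HL HB HD HDB x)].
  intros n; apply sum_n_ext; intros j; simpl Cpow; module_eq.
- assert (S0 : seq_to (fun n => scal (left_sum rho n (pow_fun k) : C) x) zero).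
  { apply seq_to_scal_vec; exact (left_sum_power rho M L k Hrho HL). }
  pose proof (seq_to_plus _ _ _ _ S0 (seq_to_linear T _ _ HT IH)) as S1.
  unfold cauchy_value.
  replace (scal (2 * PI * Ci)%C (Nat.iter (S k) T x))
    with (plus zero (T (scal (2 * PI * Ci)%C (Nat.iter k T x)))).
  2: { rewrite (linear_scal_C T HT); simpl Nat.iter; module_eq. }
  eapply seq_to_ext; [|exact S1]; intros n; cbv beta.
  unfold left_sum; rewrite (linear_sum_n T HT).
  assert (E : scal (sum_n (fun j => scal (curve rho (ang n (S j)) - curve rho (ang n j))%C
      (pow_fun k (curve rho (ang n j)))) n : C) x =
    sum_n (fun j => scal ((curve rho (ang n (S j)) - curve rho (ang n j)) *
      (curve rho (ang n j)) ^ k)%C x) n).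
  { apply scal_sum_n. }
  rewrite E; etransitivity; [symmetry; apply sum_n_plus|].
  apply sum_n_ext_loc; intros j Hj.
  set (z := curve rho (ang n j)); set (d := (_ - _)%C).
  assert (Hz : outside rho z) by (apply (outside_curve rho M L Hrho); lia).
  rewrite !(linear_scal_C T HT), Cpow_S.
  replace (scal (z * z ^ k)%C (Rz z x)) with (scal (z ^ k)%C (scal z (Rz z x)))
    by module_eq.
  rewrite (resolvent_eqn T Rz z x (HD z Hz)); module_eq.
Qed.

Lemma cauchy_value_poly (c : nat -> C) m n :
  cauchy_value (poly_eval c m n) (poly_op c m n T x).
Proof.
assert (Z : cauchy_value (fun _ => 0%C) zero).
{ eapply cauchy_value_ext; [|replace (zero : X) with (scal (RtoC 0) x) by module_eq;
    exact (cauchy_value_scal (RtoC 0) _ _ (cauchy_value_power 0))].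
  intros z; simpl; ring. }
assert (Mo : forall k, cauchy_value (fun z => c k * z ^ k)%C (scal (c k) (Nat.iter k T x))).
{ intros k; apply (cauchy_value_scal (c k) _ _ (cauchy_value_power k)). }
unfold poly_op; induction n as [|n IH].
- destruct m as [|m].
  + rewrite sum_n_n; eapply cauchy_value_ext; [|apply Mo].
    intros z; unfold poly_eval; now rewrite sum_n_n.
  + rewrite sum_n_m_zero by lia; eapply cauchy_value_ext; [|apply Z].
    intros z; unfold poly_eval; now rewrite sum_n_m_zero by lia.
- destruct (Nat.le_gt_cases m (S n)) as [H|H].
  + rewrite sum_n_Sm by easy.
    eapply cauchy_value_ext; [|apply (cauchy_value_plus _ _ _ _ IH (Mo (S n)))].
    intros z; unfold poly_eval; now rewrite (sum_n_Sm _ m n) by easy.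
  + rewrite sum_n_m_zero by lia; eapply cauchy_value_ext; [|apply Z].
    intros z; unfold poly_eval; now rewrite sum_n_m_zero by lia.
Qed.

End CauchyPolynomial.

(** * The maximum principle for polynomials *)

(** Closing monomials under sums, with no normal form for the coefficients, makes
    stability under products and powers an induction. *)
Inductive is_poly : (C -> C) -> Prop :=
| is_poly_mono c k : is_poly (fun z => c * z ^ k)%C
| is_poly_plus F G : is_poly F -> is_poly G -> is_poly (fun z => F z + G z)%C
| is_poly_ext F G : (forall z, F z = G z) -> is_poly F -> is_poly G.

Lemma is_poly_mult F G : is_poly F -> is_poly G -> is_poly (fun z => F z * G z)%C.
Proof.
intros HF HG; induction HF as [c k|F F' _ IH _ IH'|F F' E _ IH].
- induction HG as [d l|G G' _ IH _ IH'|G G' E _ IH].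
  + apply is_poly_ext with (2 := is_poly_mono (c * d)%C (k + l)).
    intros z; rewrite Cpow_add_r; ring.
  + apply is_poly_ext with (2 := is_poly_plus _ _ IH IH'); intros z; ring.
  + apply is_poly_ext with (2 := IH); intros z; now rewrite E.
- apply is_poly_ext with (2 := is_poly_plus _ _ IH IH'); intros z; ring.
- apply is_poly_ext with (2 := IH); intros z; now rewrite E.
Qed.

Lemma is_poly_pow F k : is_poly F -> is_poly (fun z => F z ^ k)%C.
Proof.
intros HF; induction k as [|k IH].
- apply is_poly_ext with (2 := is_poly_mono 1%C 0); intros z; simpl; ring.
- apply is_poly_ext with (2 := is_poly_mult _ _ HF IH); intros z; now rewrite Cpow_S.
Qed.

Lemma is_poly_sum (c : nat -> C) (e : nat -> nat) m n :
  is_poly (fun z => sum_n_m (fun k => c k * z ^ e k)%C m n).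
Proof.
assert (Z : is_poly (fun _ => 0%C)).
{ apply is_poly_ext with (2 := is_poly_mono 0%C 0); intros z; ring. }
induction n as [|n IH].
- destruct m as [|m].
  + apply is_poly_ext with (2 := is_poly_mono (c 0%nat) (e 0%nat)); intros z.
    now rewrite sum_n_n.
  + apply is_poly_ext with (2 := Z); intros z; now rewrite sum_n_m_zero by lia.
- destruct (Nat.le_gt_cases m (S n)) as [H|H].
  + apply is_poly_ext with (2 := is_poly_plus _ _ IH (is_poly_mono (c (S n)) (e (S n)))).
    intros z; now rewrite (sum_n_Sm _ m n) by easy.
  + apply is_poly_ext with (2 := Z); intros z; now rewrite sum_n_m_zero by lia.
Qed.

Lemma is_poly_eval c m n : is_poly (poly_eval c m n).
Proof. exact (is_poly_sum c (fun k => k) m n). Qed.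

Lemma Cpow_lipschitz (a b : C) k : Cmod a <= 1 -> Cmod b <= 1 ->
  Cmod (a ^ k - b ^ k) <= INR k * Cmod (a - b).
Proof.
intros Ha Hb; induction k as [|k IH].
- simpl; replace (1 - 1)%C with (RtoC 0) by ring; rewrite Cmod_0; lra.
- rewrite !Cpow_S, S_INR.
  replace (a * a ^ k - b * b ^ k)%C with (a * (a ^ k - b ^ k) + (a - b) * b ^ k)%C by ring.
  eapply Rle_trans; [apply Cmod_triangle|]; rewrite !Cmod_mult, Cmod_pow.
  assert (Cmod b ^ k <= 1).
  { rewrite <- (pow1 k); apply pow_incr; split; [apply Cmod_ge_0|easy]. }
  pose proof (Cmod_ge_0 (a ^ k - b ^ k)); pose proof (Cmod_ge_0 (a - b)); nra.
Qed.

Lemma is_poly_lipschitz F : is_poly F -> exists K, 0 <= K /\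
  forall a b, Cmod a <= 1 -> Cmod b <= 1 -> Cmod (F a - F b) <= K * Cmod (a - b).
Proof.
intros HF; induction HF as [c k|F G _ [K [HK IH]] _ [K' [HK' IH']]|F G E _ [K [HK IH]]].
- exists (Cmod c * INR k); split.
  { apply Rmult_le_pos; [apply Cmod_ge_0|apply pos_INR]. }
  intros a b Ha Hb; replace (c * a ^ k - c * b ^ k)%C with (c * (a ^ k - b ^ k))%C by ring.
  rewrite Cmod_mult, Rmult_assoc; apply Rmult_le_compat_l; [apply Cmod_ge_0|].
  now apply Cpow_lipschitz.
- exists (K + K'); split; [lra|]; intros a b Ha Hb.
  replace (F a + G a - (F b + G b))%C with ((F a - F b) + (G a - G b))%C by ring.
  eapply Rle_trans; [apply Cmod_triangle|].
  specialize (IH a b Ha Hb); specialize (IH' a b Ha Hb); lra.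
- exists K; split; [easy|]; intros a b Ha Hb; rewrite <- !E; auto.
Qed.

Section Scalar.
Variable w : C.
Hypothesis Hw : Cmod w < 1.

Definition mul_w (y : C_NormedModule) : C_NormedModule := (w * y)%C.
Definition div_w (z : C) (y : C_NormedModule) : C_NormedModule := (/ (z - w) * y)%C.

Lemma unit_circle : radial_curve (fun _ => 1) 1 0.
Proof.
split; [intros; lra| |easy].
intros t u _ _; rewrite Rminus_diag, Rabs_R0; lra.
Qed.

Lemma outside_unit z : outside (fun _ => 1) z -> 1 - Cmod w <= Cmod (z - w).
Proof.
intros [t [r [_ [Hr ->]]]].
pose proof (Cmod_triangle (r * cis t - w)%C w) as H.
replace (r * cis t - w + w)%C with (r * cis t)%C in H by ring.
rewrite Cmod_Rmult_cis in H by lra; lra.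
Qed.

Lemma div_w_resolvent z : outside (fun _ => 1) z -> is_resolvent mul_w z (div_w z).
Proof.
intros Hz; apply outside_unit in Hz.
assert (N : (z - w)%C <> 0%C) by (apply Cmod_gt_0; lra).
split; [|split].
- exact (is_linear_scal_C (X := C_NormedModule) (/ (z - w))%C).
- intros y; change ((/ (z - w) * (z * y - w * y))%C = y :> C); field; easy.
- intros y; change ((z * (/ (z - w) * y) - w * (/ (z - w) * y))%C = y :> C); field; easy.
Qed.

Lemma cauchy_value_scalar F : is_poly F ->
  cauchy_value div_w (fun _ => 1) (RtoC 1 : C_NormedModule) F (F w).
Proof.
intros HF; induction HF as [c k|F G _ IH _ IH'|F G E _ IH].
- assert (Ew : (c * w ^ k)%C
    = scal c (Nat.iter k mul_w (RtoC 1 : C_NormedModule)) :> C_NormedModule).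
  { change (c * w ^ k = c * Nat.iter k (Cmult w) 1)%C; f_equal.
    induction k as [|k IH]; [easy|]; simpl Nat.iter; now rewrite <- IH, Cpow_S. }
  rewrite Ew; apply (cauchy_value_scal div_w (fun _ => 1)).
  apply (cauchy_value_power mul_w (is_linear_scal_C (X := C_NormedModule) w) div_w _
    1 0 (/ (1 - Cmod w)) unit_circle).
  + apply Rle_refl.
  + left; apply Rinv_0_lt_compat; lra.
  + apply div_w_resolvent.
  + intros z Hz y; apply outside_unit in Hz.
    change (Cmod (/ (z - w) * y) <= / (1 - Cmod w) * Cmod y).
    rewrite Cmod_mult, Cmod_inv by (apply Cmod_gt_0; lra).
    apply Rmult_le_compat_r; [apply Cmod_ge_0|]; apply Rinv_le_contravar; lra.
- now apply (cauchy_value_plus div_w (fun _ => 1) _ F G).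
- rewrite <- E; now apply cauchy_value_ext with (1 := E).
Qed.

(** Scalar Cauchy formula on the unit circle, with [|z - w| >= 1 - |w|] there. *)
Lemma poly_le_cauchy F K : is_poly F ->
  (forall z, Cmod z = 1 -> Cmod (F z) <= K) -> Cmod (F w) <= K / (1 - Cmod w).
Proof.
intros HF HK.
pose proof PI_RGT_0 as HPI.
assert (HK0 : 0 <= K).
{ eapply Rle_trans; [apply Cmod_ge_0|apply (HK 1%C), Cmod_1]. }
assert (H : norm (scal (2 * PI * Ci)%C (F w : C_NormedModule)) <= 2 * PI * (K / (1 - Cmod w))).
{ eapply seq_to_norm_le with (b := fun _ => 2 * PI * (K / (1 - Cmod w)));
    [apply (cauchy_value_scalar F HF)| |apply is_lim_seq_const].
  intros n; pose proof (INR_S_pos n) as Hn.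
  replace (2 * PI * (K / (1 - Cmod w)))
    with (INR (S n) * ((2 * PI / INR (S n)) * (K / (1 - Cmod w)))) by (field; lra).
  apply norm_sum_n_const; intros j Hj.
  pose proof (radial_curve_step _ _ _ n j unit_circle Hj) as Hs.
  pose proof (outside_curve _ _ _ unit_circle n j ltac:(lia)) as Ho.
  apply outside_unit in Ho.
  assert (Hc : Cmod (curve (fun _ => 1) (ang n j)) = 1).
  { unfold curve; apply Cmod_Rmult_cis; lra. }
  set (z := curve _ (ang n j)) in *; set (d := (_ - z)%C) in *.
  change (Cmod (d * (F z * (/ (z - w) * 1))) <= 2 * PI / INR (S n) * (K / (1 - Cmod w))).
  rewrite !Cmod_mult, Cmod_1, Rmult_1_r, Cmod_inv by (apply Cmod_gt_0; lra).
  apply Rmult_le_compat; [apply Cmod_ge_0| |lra|].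
  - apply Rmult_le_pos; [apply Cmod_ge_0|left; apply Rinv_0_lt_compat; lra].
  - apply Rmult_le_compat; [apply Cmod_ge_0| |auto|].
    + left; apply Rinv_0_lt_compat; lra.
    + apply Rinv_le_contravar; lra. }
rewrite norm_scal_eq in H; change (norm (F w : C_NormedModule)) with (Cmod (F w)) in H.
rewrite !Cmod_mult, Cmod_Ci, !Cmod_R, !Rabs_pos_eq in H by lra.
apply Rmult_le_reg_l with (2 * PI); lra.
Qed.

End Scalar.

(** The Cauchy formula for [F^k] gives [|F w|^k <= K^k / (1 - |w|)]; as [k] grows, the
    factor [1 / (1 - |w|)] disappears on taking [k]-th roots. *)
Lemma max_principle F K w : is_poly F ->
  (forall z, Cmod z = 1 -> Cmod (F z) <= K) -> Cmod w <= 1 -> Cmod (F w) <= K.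
Proof.
intros HF HK [Hw|Hw]; [|now apply HK].
assert (HK0 : 0 <= K).
{ eapply Rle_trans; [apply Cmod_ge_0|apply (HK 1%C), Cmod_1]. }
assert (Hpow : forall k, Cmod (F w) ^ k <= K ^ k / (1 - Cmod w)).
{ intros k; rewrite <- Cmod_pow.
  apply (poly_le_cauchy w Hw (fun z => F z ^ k)%C); [now apply is_poly_pow|].
  intros z Hz; rewrite Cmod_pow; apply pow_incr; split; [apply Cmod_ge_0|auto]. }
apply Rnot_lt_le; intros Hlt.
assert (K <> 0) as HKn.
{ intros ->; specialize (Hpow 1%nat).
  unfold Rdiv in Hpow; rewrite !pow_1, Rmult_0_l in Hpow; lra. }
assert (Hq : 1 < Cmod (F w) / K).
{ apply Rmult_lt_reg_r with K; [lra|]; unfold Rdiv; rewrite Rmult_assoc, Rinv_l by easy; lra. }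
destruct (Pow_x_infinity (Cmod (F w) / K)) with (b := / (1 - Cmod w) + 1) as [N HN].
{ rewrite Rabs_pos_eq; lra. }
specialize (HN N (Nat.le_refl N)); specialize (Hpow N).
rewrite Rabs_pos_eq in HN by (apply pow_le; lra).
unfold Rdiv in HN; rewrite Rpow_mult_distr, pow_inv in HN.
assert (HKN : 0 < K ^ N) by (apply pow_lt; lra).
assert (Cmod (F w) ^ N * / K ^ N <= / (1 - Cmod w)); [|lra].
apply Rmult_le_reg_r with (K ^ N); [easy|].
rewrite Rmult_assoc, Rinv_l by lra; unfold Rdiv in Hpow; lra.
Qed.

(** The supremum norm is taken over the open disc, but the maximum principle needs the
    circle; the Lipschitz bound carries the estimate across. *)
Lemma poly_boundary F K z : is_poly F ->
  (forall w, Cmod w < 1 -> Cmod (F w) <= K) -> Cmod z = 1 -> Cmod (F z) <= K.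
Proof.
intros HF HK Hz; destruct (is_poly_lipschitz F HF) as [L [HL HLip]].
apply Rnot_lt_le; intros Hlt.
set (e := Rmin (1 / 2) ((Cmod (F z) - K) / (2 * (L + 1)))).
assert (He2 : e <= (Cmod (F z) - K) / (2 * (L + 1))) by apply Rmin_r.
assert (He1 : e <= 1 / 2) by apply Rmin_l.
assert (He : 0 < e).
{ apply Rmin_pos; [lra|]; apply Rdiv_lt_0_compat; lra. }
assert (Hm : Cmod ((1 - e)%R * z)%C = 1 - e).
{ rewrite Cmod_mult, Cmod_R, Hz, Rabs_pos_eq by lra; ring. }
pose proof (HK ((1 - e)%R * z)%C ltac:(lra)) as H1.
pose proof (HLip z ((1 - e)%R * z)%C ltac:(lra) ltac:(lra)) as H2.
replace (z - (1 - e)%R * z)%C with (e * z)%C in H2 by (rewrite RtoC_minus; ring).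
rewrite Cmod_mult, Cmod_R, Hz, Rabs_pos_eq in H2 by lra.
pose proof (Cmod_triangle (F z - F ((1 - e)%R * z)%C) (F ((1 - e)%R * z)%C)) as H3.
replace (F z - F ((1 - e)%R * z)%C + F ((1 - e)%R * z)%C)%C with (F z) in H3 by ring.
apply Rle_div_r in He2; [nra|lra].
Qed.

Lemma poly_eval_le_disc_sup_norm c m n z : Cmod z < 1 ->
  Cmod (poly_eval c m n z) <= disc_sup_norm (poly_eval c m n).
Proof.
intros Hz; unfold disc_sup_norm.
set (E := fun r : R => _).
destruct (is_poly_lipschitz _ (is_poly_eval c m n)) as [K [HK HL]].
set (F := poly_eval c m n) in *.
destruct (Lub_Rbar_correct E) as [Hub Hlub].
assert (H1 : Rbar_le (Cmod (poly_eval c m n z)) (Lub_Rbar E)).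
{ apply Hub; now exists z. }
assert (H2 : Rbar_le (Lub_Rbar E) (K + Cmod (F 0%C))).
{ apply Hlub; intros r [w [Hw ->]];   change (Cmod (F w) <= K + Cmod (F 0%C)).
  specialize (HL w 0%C ltac:(lra) ltac:(rewrite Cmod_0; lra)).
  pose proof (Cmod_triangle (F w - F 0%C) (F 0%C)) as H3.
  replace (F w - F 0%C + F 0%C)%C with (F w) in H3 by ring.
  replace (w - 0)%C with w in HL by ring; nra. }
destruct (Lub_Rbar E); simpl in *; easy.
Qed.

Lemma poly_eval_le_circle c m n z : Cmod z = 1 ->
  Cmod (poly_eval c m n z) <= disc_sup_norm (poly_eval c m n).
Proof.
intros Hz; apply (poly_boundary (poly_eval c m n)); [apply is_poly_eval|apply poly_eval_le_disc_sup_norm|easy].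
Qed.

(** Schwarz lemma: [p / z^m] is a polynomial with the same modulus as [p] on the
    circle. *)
Lemma poly_eval_le_inside c m n z : (m <= n)%nat -> Cmod z <= 1 ->
  Cmod (poly_eval c m n z) <= Cmod z ^ m * disc_sup_norm (poly_eval c m n).
Proof.
intros Hmn Hz.
pose (q := (fun z => sum_n_m (fun k => c k * z ^ (k - m))%C m n) : C -> C).
assert (E : forall z, poly_eval c m n z = (z ^ m * q z)%C).
{ intros v; unfold q; etransitivity; [|exact (sum_n_m_mult_l (K := C_Ring) (v ^ m)%C _ m n)].
  apply sum_n_m_ext_loc; intros k Hk.
  change (c k * v ^ k = v ^ m * (c k * v ^ (k - m)))%C.
  replace k with (m + (k - m))%nat at 2 by lia; rewrite Cpow_add_r.
  set (u := (v ^ m)%C); set (t := (v ^ (k - m))%C); set (d := c k).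
  change ((d * (u * t))%C = (u * (d * t))%C :> C); ring. }
rewrite E, Cmod_mult, Cmod_pow.
apply Rmult_le_compat_l; [apply pow_le, Cmod_ge_0|].
apply max_principle; [apply is_poly_sum| |easy].
intros v Hv; apply Rle_trans with (2 := poly_eval_le_circle c m n v Hv).
rewrite E, Cmod_mult, Cmod_pow, Hv, pow1; lra.
Qed.

(** Bernstein's inequality: apply the maximum principle to the reversed
    polynomial [z^n p(1/z)]. *)
Lemma poly_eval_le_outside c m n z : (m <= n)%nat -> 1 <= Cmod z ->
  Cmod (poly_eval c m n z) <= Cmod z ^ n * disc_sup_norm (poly_eval c m n).
Proof.
intros Hmn Hz.
pose (q := (fun z => sum_n_m (fun k => c k * z ^ (n - k))%C m n) : C -> C).
assert (E : forall z : C, z <> 0%C -> poly_eval c m n z = (z ^ n * q (/ z))%C).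
{ intros v Hv; unfold q; etransitivity; [|exact (sum_n_m_mult_l (K := C_Ring) (v ^ n)%C _ m n)].
  apply sum_n_m_ext_loc; intros k Hk.
  assert (En : (v ^ n = v ^ k * v ^ (n - k))%C) 
    by (rewrite <- Cpow_add_r; now replace (k + (n - k))%nat with n by lia).
  assert (Ei : ((/ v) ^ (n - k) = / v ^ (n - k))%C) by now apply Cpow_inv.
  rewrite En, Ei; assert (Ht : (v ^ (n - k))%C <> 0%C) by now apply Cpow_nz.
  revert Ht; generalize (v ^ (n - k))%C (v ^ k)%C (c k); intros t u d Ht.
  change ((d * u)%C = (u * t * (d * / t))%C :> C); field; easy. }
assert (Hz0 : z <> 0%C) by (apply Cmod_gt_0; lra).
rewrite E, Cmod_mult, Cmod_pow by easy.
apply Rmult_le_compat_l; [apply pow_le, Cmod_ge_0|].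
apply max_principle; [apply is_poly_sum| |].
- intros v Hv.
  assert (Hv0 : v <> 0%C) by (apply Cmod_gt_0; lra).
  assert (Hv1 : Cmod (/ v) = 1) by (rewrite Cmod_inv, Hv by easy; apply Rinv_1).
  apply Rle_trans with (2 := poly_eval_le_circle c m n (/ v)%C Hv1).
  assert (Hiv : (/ v)%C <> 0%C) by (apply Cmod_gt_0; lra).
  rewrite (E _ Hiv), Cmod_mult, Cmod_pow, Hv1, pow1.
  replace (/ / v)%C with v by (field; easy); lra.
- rewrite Cmod_inv by easy; rewrite <- Rinv_1; apply Rinv_le_contravar; lra.
Qed.

(** * Resolvents of Tadmor-Ritt operators *)

Lemma norm_le_op_norm {X : NormedModule C_AbsRing} (S : X -> X) x :
  is_linear S -> norm (S x) <= op_norm S * norm x.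
Proof.
intros HS; pose proof (op_norm_finite X S HS) as Hf.
assert (H1 : forall y, norm y <= 1 -> norm (S y) <= op_norm S).
{ intros y Hy; unfold op_norm.
  set (E := fun r : R => _) in *; destruct (Lub_Rbar_correct E) as [Hub _].
  assert (H : Rbar_le (norm (S y)) (Lub_Rbar E)) by (apply Hub; now exists y).
  rewrite <- Hf in H; exact H. }
destruct (Req_dec (norm x) 0) as [H0|H0].
- rewrite H0; destruct HS as [_ _ [M [HM HSM]]].
  specialize (HSM x); rewrite H0 in HSM; lra.
- pose proof (norm_ge_0 x) as Hx.
  assert (Hi : Cmod (/ norm x)%R = / norm x).
  { rewrite Cmod_R; apply Rabs_pos_eq; left; apply Rinv_0_lt_compat; lra. }
  assert (H2 : norm (S (scal (RtoC (/ norm x)) x)) <= op_norm S).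
  { apply H1; rewrite norm_scal_eq, Hi; right; field; easy. }
  rewrite (linear_scal_C S HS), norm_scal_eq, Hi in H2.
  apply Rmult_le_reg_l with (/ norm x); [apply Rinv_0_lt_compat; lra|].
  replace (/ norm x * (op_norm S * norm x)) with (op_norm S) by (field; easy); easy.
Qed.

Lemma op_norm_le {X : NormedModule C_AbsRing} (S : X -> X) K :
  0 <= K -> (forall x, norm x <= 1 -> norm (S x) <= K) -> op_norm S <= K.
Proof.
intros HK H; unfold op_norm.
set (E := fun r : R => _); destruct (Lub_Rbar_correct E) as [_ Hlub].
assert (G : Rbar_le (Lub_Rbar E) K) by (apply Hlub; intros r [x [Hx ->]]; now apply H).
destruct (Lub_Rbar E); simpl in *; easy.
Qed.

Lemma is_linear_zI_minus {X : NormedModule C_AbsRing} (T : X -> X) z :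
  is_linear T -> is_linear (zI_minus z T).
Proof.
intros HT; pose proof HT as [_ _ [K [HK HTK]]]; split.
- intros x y; unfold zI_minus; rewrite (linear_plus T HT); module_eq.
- intros k x; change (zI_minus z T (scal (k : C) x) = scal (k : C) (zI_minus z T x)).
  unfold zI_minus; rewrite (linear_scal_C T HT); module_eq.
- exists (Cmod z + K); split; [pose proof (Cmod_ge_0 z); lra|].
  intros x; unfold zI_minus; eapply Rle_trans; [apply norm_minus_le|].
  pose proof (norm_scal_C z x); specialize (HTK x); lra.
Qed.

Lemma seq_to_unique {X : NormedModule C_AbsRing} (u : nat -> X) l l' :
  seq_to u l -> seq_to u l' -> l = l'.
Proof.
intros H H'.
assert (E : norm (minus l l') <= 0 + 0).
{ apply (is_lim_seq_le (fun _ => norm (minus l l'))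
    (fun n => norm (minus (u n) l) + norm (minus (u n) l')) (norm (minus l l')) (0 + 0)).
  - intros n; rewrite (norm_minus_sym (u n) l); apply norm_triangle_minus.
  - apply is_lim_seq_const.
  - now apply is_lim_seq_plus'. }
pose proof (norm_ge_0 (minus l l')).
assert (Z : minus l l' = zero) by (apply norm_eq_zero; lra).
replace l with (plus (minus l l') l') by module_eq; rewrite Z; module_eq.
Qed.

Lemma seq_to_filterlim {X : NormedModule C_AbsRing} (u : nat -> X) l :
  filterlim u eventually (locally l) -> seq_to u l.
Proof.
intros H; apply seq_to_eps; intros eps.
apply filterlim_locally_ball_norm with (eps := eps) in H.
destruct H as [N HN]; exists N; intros n Hn; left; exact (HN n Hn).
Qed.

Section Neumann.
Context {X : CompleteNormedModule C_AbsRing}.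
Variable T : X -> X.
Hypothesis HT : is_linear T.

Lemma resolvent_is_resolvent z : resolvent_set T z -> is_resolvent T z (resolvent z T).
Proof. exact (resolvent_correct X T z). Qed.

(** Perturbation of an invertible operator: the Neumann series in the resolvent
    at [z] solves the equation at a nearby point [w]. *)
Lemma neumann_surjective z w (A : X -> X) K :
  is_resolvent T z A -> 0 <= K -> (forall x, norm (A x) <= K * norm x) ->
  Cmod (z - w) * K < 1 -> forall x, exists y, zI_minus w T y = x.
Proof.
intros [LA [HA1 HA2]] HK HAK Hq x.
set (q := Cmod (z - w) * K) in *.
assert (Hq0 : 0 <= q) by (apply Rmult_le_pos; [apply Cmod_ge_0|easy]).
set (a := fix a k := match k with O => A x | S k => scal (z - w)%C (A (a k)) end : X).
assert (Ha : forall k, norm (a k) <= K * norm x * q ^ k).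
{ induction k as [|k IH]; simpl.
  - rewrite Rmult_1_r; apply HAK.
  - eapply Rle_trans; [apply (norm_scal_C (X := X))|].
    specialize (HAK (a k)).
    replace (K * norm x * (q * q ^ k)) with (Cmod (z - w) * (K * (K * norm x * q ^ k)))
      by (unfold q; ring).
    apply Rmult_le_compat_l; [apply Cmod_ge_0|].
    eapply Rle_trans; [apply HAK|]; now apply Rmult_le_compat_l. }
assert (Hs : ex_series a).
{ apply ex_series_le with (1 := Ha).
  apply (ex_series_scal_l (K * norm x) (fun k => q ^ k)), ex_series_geom.
  rewrite Rabs_pos_eq; lra. }
destruct Hs as [y Hy]; exists y.
apply seq_to_filterlim in Hy.
apply (seq_to_unique (fun n => zI_minus w T (sum_n a n))).
{ apply seq_to_linear; [now apply is_linear_zI_minus|easy]. }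
assert (E : forall v, zI_minus w T v = minus (zI_minus z T v) (scal (z - w)%C v)).
{ intros v; unfold zI_minus; module_eq. }
assert (Es : forall n, zI_minus w T (sum_n a n) = minus x (scal (z - w)%C (a n))).
{ induction n as [|n IH].
  - rewrite sum_O, E; simpl; now rewrite HA2.
  - rewrite sum_Sn, (linear_plus _ (is_linear_zI_minus T w HT)), IH, E; simpl a.
    rewrite (linear_scal_C _ (is_linear_zI_minus T z HT)), HA2; module_eq. }
apply seq_to_le with (fun n => Cmod (z - w) * (K * norm x) * q ^ n).
- intros n; rewrite Es.
  norm_as (scal (z - w)%C (opp (a n))).
  eapply Rle_trans; [apply (norm_scal_C (X := X))|]; rewrite (norm_opp (V := X)), Rmult_assoc.
  apply Rmult_le_compat_l; [apply Cmod_ge_0|apply Ha].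
- replace (Finite 0) with (Rbar_mult (Cmod (z - w) * (K * norm x)) 0)
    by (simpl; f_equal; ring).
  apply is_lim_seq_scal_l, is_lim_seq_geom; rewrite Rabs_pos_eq; lra.
Qed.

(** A lower bound gives injectivity, hence uniqueness in the definition of the resolvent,
    and it is also the norm bound for the inverse. *)
Lemma resolvent_of_lower_bound w c : 0 < c ->
  (forall y, c * norm y <= norm (zI_minus w T y)) ->
  (forall x, exists y, zI_minus w T y = x) ->
  resolvent_set T w /\ forall x, norm (resolvent w T x) <= / c * norm x.
Proof.
intros Hc Hlow Hsurj.
pose proof (is_linear_zI_minus T w HT) as LW.
assert (Hinj : forall y y', zI_minus w T y = zI_minus w T y' -> y = y').
{ intros y y' E.
  assert (Z : minus y y' = zero).
  { apply norm_eq_zero, Rle_antisym; [|apply norm_ge_0].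
    specialize (Hlow (minus y y')); rewrite (linear_minus_C _ LW), E in Hlow.
    assert (Z : norm (minus (zI_minus w T y') (zI_minus w T y')) = 0).
    { rewrite <- (norm_zero (V := X)); f_equal; module_eq. }
    rewrite Z in Hlow; apply Rmult_le_reg_l with c; lra. }
  replace y with (plus (minus y y') y') by module_eq; rewrite Z; module_eq. }
assert (HR : forall x, zI_minus w T (resolvent w T x) = x).
{ intros x; apply (iota_correct (fun y : X => zI_minus w T y = x)).
  destruct (Hsurj x) as [y Hy]; exists y; split; [easy|].
  intros y' Hy'; apply Hinj; congruence. }
assert (HRb : forall x, norm (resolvent w T x) <= / c * norm x).
{ intros x; apply Rmult_le_reg_l with c; [easy|].
  rewrite <- Rmult_assoc, Rinv_r, Rmult_1_l by lra.
  rewrite <- (HR x) at 2; apply Hlow. }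
split; [|easy].
exists (resolvent w T); split; [split|split; [|easy]].
- intros x y; apply Hinj; rewrite (linear_plus _ LW), !HR; reflexivity.
- intros k x; apply Hinj.
  change (zI_minus w T (resolvent w T (scal (k : C) x))
    = zI_minus w T (scal (k : C) (resolvent w T x))).
  rewrite (linear_scal_C _ LW), !HR; reflexivity.
- exists (/ c); split; [now apply Rinv_0_lt_compat|easy].
- intros x; apply Hinj; apply HR.
Qed.

End Neumann.

Section TadmorRitt.
Context {X : CompleteNormedModule C_AbsRing}.
Variable T : X -> X.
Hypothesis HTR : Tadmor_Ritt T.
Let K := real (TR_const T).

Lemma TR_resolvent_set z : 1 < Cmod z -> resolvent_set T z.
Proof.
destruct HTR as [_ [Hsp _]]; intros Hz; apply NNPP; intros H.
specialize (Hsp z H); lra.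
Qed.

Lemma TR_resolvent_le z x : 1 < Cmod z ->
  Cmod (z - 1) * norm (resolvent z T x) <= K * norm x.
Proof.
intros Hz; pose proof HTR as [HT [_ Hfin]].
pose proof (resolvent_is_resolvent T z (TR_resolvent_set z Hz)) as [LR _].
set (S := fun x : X => scal (z - 1)%C (resolvent z T x)).
assert (LS : is_linear S).
{ split.
  - intros u v; unfold S; rewrite (linear_plus _ LR); module_eq.
  - intros k u; change (S (scal (k : C) u) = scal (k : C) (S u)).
    unfold S; rewrite (linear_scal_C _ LR); module_eq.
  - destruct LR as [_ _ [M [HM HLM]]]; exists (Cmod (z - 1) * M + 1).
    pose proof (Cmod_ge_0 (z - 1)); split; [nra|].
    intros u; unfold S; eapply Rle_trans; [apply (norm_scal_C (X := X))|].
    specialize (HLM u); pose proof (norm_ge_0 u); nra. }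
pose proof (norm_le_op_norm S x LS) as H1.
assert (H2 : op_norm S <= K).
{ unfold K, TR_const; unfold TR_const in Hfin.
  set (E := fun r : R => _) in *; destruct (Lub_Rbar_correct E) as [Hub _].
  assert (H : Rbar_le (op_norm S) (Lub_Rbar E)) by (apply Hub; now exists z).
  rewrite <- Hfin in H; exact H. }
unfold S in H1 at 1; rewrite (norm_scal_eq (X := X)) in H1.
pose proof (norm_ge_0 x); nra.
Qed.

Lemma TR_lower_bound z y : 1 < Cmod z ->
  Cmod (z - 1) * norm y <= K * norm (zI_minus z T y).
Proof.
intros Hz.
pose proof (resolvent_is_resolvent T z (TR_resolvent_set z Hz)) as [_ [H _]].
rewrite <- (H y) at 1; now apply TR_resolvent_le.
Qed.

(** As [z] tends to infinity, [(z - 1) R(z)] tends to the identity, whose norm is [1] on a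
    nonzero space. *)
Lemma TR_const_ge_1 : (exists x : X, x <> zero) -> 1 <= K.
Proof.
intros [x Hx]; pose proof HTR as [HT _]; destruct HT as [_ _ [M [HM HTM]]].
assert (Nx : 0 < norm x) by now apply norm_gt_0.
assert (H : forall r, 1 < r -> r - 1 <= K * (r + M)).
{ intros r Hr.
  assert (Er : Cmod r = r) by (rewrite Cmod_R; apply Rabs_pos_eq; lra).
  pose proof (TR_lower_bound r x ltac:(lra)) as H.
  rewrite <- RtoC_minus, Cmod_R, Rabs_pos_eq in H by lra.
  assert (H2 : norm (zI_minus r T x) <= (r + M) * norm x).
  { unfold zI_minus; eapply Rle_trans; [apply norm_minus_le|].
    pose proof (norm_scal_C r x) as H1; rewrite Er in H1; specialize (HTM x); lra. }
  assert (HK : 0 <= K).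
  { pose proof (norm_ge_0 (zI_minus r T x)); apply Rnot_lt_le; intros HK; nra. }
  apply Rmult_le_reg_r with (norm x); [easy|]; nra. }
apply Rnot_lt_le; intros HK.
assert (HD : 0 < 1 - K) by lra.
set (r := (Rabs K * M + 2) / (1 - K) + 2).
pose proof (Rle_abs K) as HKa; pose proof (Rabs_pos K) as HKp.
assert (Hq : 0 < (Rabs K * M + 2) / (1 - K)) by (apply Rdiv_lt_0_compat; nra).
specialize (H r ltac:(unfold r; lra)).
assert (Hr : (1 - K) * r = Rabs K * M + 2 + 2 * (1 - K)) by (unfold r; field; lra).
nra.
Qed.

End TadmorRitt.

(** * The integration curve *)

(** The distance [|cis t - 1|] for [t] between [0] and [2 PI], where [sin (t / 2)] is
    nonnegative. *)
Definition chord (t : R) : R := 2 * sin (t / 2).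

Lemma chord_range t : 0 <= t <= 2 * PI -> 0 <= chord t <= 2.
Proof.
intros Ht; unfold chord; pose proof (SIN_bound (t / 2)).
pose proof (sin_ge_0 (t / 2) ltac:(lra) ltac:(lra)); lra.
Qed.

Lemma chord_lipschitz t u : Rabs (chord t - chord u) <= Rabs (t - u).
Proof.
unfold chord.
replace (2 * sin (t / 2) - 2 * sin (u / 2)) with (2 * (sin (t / 2) - sin (u / 2))) by ring.
rewrite Rabs_mult, (Rabs_pos_eq 2) by lra.
assert (H : Rabs (sin (t / 2) - sin (u / 2)) <= Rabs (t / 2 - u / 2)).
{ eapply Rle_trans; [|apply Cmod_cis_minus].
  eapply Rle_trans; [|apply Rmax_Cmod]; apply Rmax_r. }
replace (t / 2 - u / 2) with (/ 2 * (t - u)) in H by field.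
rewrite Rabs_mult, (Rabs_pos_eq (/ 2)) in H by lra; lra.
Qed.

Lemma chord_sym t : chord (2 * PI - t) = chord t.
Proof.
unfold chord; f_equal; replace ((2 * PI - t) / 2) with (PI - t / 2) by field.
apply sin_PI_x.
Qed.

(** Needed for [sin u >= u / 2] up to [PI / 2] through the cubic lower bound, which
    requires [(PI / 2)^2 <= 3]; it holds because [cos (17 / 10)] is negative. *)
Lemma PI_le_34 : PI <= 34 / 10.
Proof.
apply Rnot_lt_le; intros H.
destruct (cos_bound (17 / 10) 0 ltac:(lra) ltac:(lra)) as [_ H1].
pose proof (cos_ge_0 (17 / 10) ltac:(lra) ltac:(lra)).
unfold cos_approx, cos_term in H1; simpl in H1; lra.
Qed.

Lemma chord_ge_half t : 0 <= t <= PI -> t / 2 <= chord t.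
Proof.
intros Ht; unfold chord; pose proof PI_le_34.
pose proof (sin_ge_cubic (t / 2) ltac:(lra)) as H1.
assert (H2 : 0 <= t / 2 * (3 - (t / 2) ^ 2)) by nra.
lra.
Qed.

Lemma Cmod_cis_minus_1 r t d : 0 < d -> 1 + d <= r -> 0 <= t <= 2 * PI ->
  7 / 10 * (d + chord t) <= Cmod (r * cis t - 1).
Proof.
intros Hd Hr Ht; pose proof (chord_range t Ht) as Hc.
apply Rsqr_incr_0_var; [|apply Cmod_ge_0].
rewrite !Rsqr_pow2, Cmod2_alt.
assert (E : Re (r * cis t - 1)%C ^ 2 + Im (r * cis t - 1)%C ^ 2
  = (r - 1) ^ 2 + r * chord t ^ 2).
{ unfold cis, chord, Cmult, Cminus, Cplus, Copp, RtoC; simpl.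
  assert (D : cos t = 1 - 2 * sin (t / 2) * sin (t / 2)).
  { rewrite <- cos_2a_sin; f_equal; field. }
  pose proof (sin2_cos2 t) as S2; unfold Rsqr in S2; nra. }
rewrite E; set (c := chord t) in *.
assert (H1 : d ^ 2 <= (r - 1) ^ 2) by (apply pow_incr; lra).
assert (H2 : 1 * c ^ 2 <= r * c ^ 2) by (apply Rmult_le_compat_r; [apply pow2_ge_0|lra]).
pose proof (pow2_ge_0 (d - c)); nra.
Qed.

Lemma exp_le_compat x y : x <= y -> exp x <= exp y.
Proof. intros [H|<-]; [left; now apply exp_increasing|apply Rle_refl]. Qed.

Section Curve.
Context {X : CompleteNormedModule C_AbsRing}.
Variable T : X -> X.
Hypothesis HTR : Tadmor_Ritt T.
Let K := real (TR_const T).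
Hypothesis HK : 1 <= K.
Variable d : R.
Hypothesis Hd : 0 < d <= / 16.

(** The slope [1 / (16 K)] is small enough for a Neumann series, centred outside the
    disc at the same argument, to reach the curve. *)
Definition radius (t : R) : R := 1 + d - chord t / (16 * K).

Lemma slope_le u : 0 <= u -> 0 <= u / (16 * K) <= u / 16.
Proof.
intros Hu; split; [apply Rdiv_le_0_compat; lra|].
apply Rmult_le_compat_l; [easy|]; apply Rinv_le_contravar; lra.
Qed.

Lemma radial_curve_radius : radial_curve radius (1 + d) (/ 16).
Proof.
split.
- intros t Ht; pose proof (chord_range t Ht) as Hc; unfold radius.
  pose proof (slope_le (chord t) ltac:(lra)); lra.
- intros t u _ _; unfold radius.
  replace (_ - _) with (- ((chord t - chord u) * / (16 * K))) by (field; lra).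
  rewrite Rabs_Ropp, Rabs_mult, (Rabs_pos_eq (/ _)).
  2: { left; apply Rinv_0_lt_compat; lra. }
  rewrite Rmult_comm; apply Rmult_le_compat; try apply Rabs_pos.
  + left; apply Rinv_0_lt_compat; lra.
  + apply Rinv_le_contravar; lra.
  + apply chord_lipschitz.
- unfold radius, chord; replace (2 * PI / 2) with PI by field.
  replace (0 / 2) with 0 by field; now rewrite sin_PI, sin_0.
Qed.

(** Compare [r cis t] with the point of the same argument and modulus at least
    [1 + d], where the Tadmor-Ritt bound holds. *)
Lemma TR_resolvent_outside t r : 0 <= t <= 2 * PI -> radius t <= r ->
  resolvent_set T (r * cis t)%C /\ forall x,
  norm (resolvent (r * cis t)%C T x) <= 8 / 5 * K / (d + chord t) * norm x.
Proof.
intros Ht Hr; pose proof (proj1 HTR) as HT.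
pose proof (chord_range t Ht) as Hc; unfold radius in Hr.
pose proof (slope_le (chord t) ltac:(lra)) as Hs.
set (R1 := Rmax r (1 + d)).
assert (HR1 : 1 + d <= R1) by apply Rmax_r.
set (z := (R1 * cis t)%C); set (w := (r * cis t)%C).
assert (Hz : 1 < Cmod z) by (unfold z; rewrite Cmod_Rmult_cis; lra).
pose proof (Cmod_cis_minus_1 R1 t d (proj1 Hd) HR1 Ht) as Hz1; fold z in Hz1.
assert (Hzw : Cmod (z - w) <= chord t / (16 * K)).
{ replace (z - w)%C with ((R1 - r)%R * cis t)%C
    by (unfold z, w; rewrite RtoC_minus; ring).
  assert (0 <= R1 - r <= chord t / (16 * K)).
  { unfold R1; split; [pose proof (Rmax_l r (1 + d)); lra|].
    apply Rmax_case; lra. }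
  rewrite Cmod_Rmult_cis; lra. }
assert (HzwK : K * Cmod (z - w) <= chord t / 16).
{ replace (chord t / 16) with (K * (chord t / (16 * K))) by (field; lra).
  apply Rmult_le_compat_l; lra. }
pose proof (Cmod_ge_0 (z - w)) as Hzw0.
assert (Hp : 0 < Cmod (z - 1)) by lra.
replace (8 / 5 * K / (d + chord t)) with (/ (5 / 8 * (d + chord t) / K)) by (field; lra).
apply resolvent_of_lower_bound; [easy| | |].
- apply Rdiv_lt_0_compat; lra.
- intros y; pose proof (TR_lower_bound T HTR z y Hz) as Hlow; fold K in Hlow.
  assert (Hsub : norm (zI_minus z T y) <= norm (zI_minus w T y) + Cmod (z - w) * norm y).
  { assert (E : zI_minus z T y = plus (zI_minus w T y) (scal (z - w)%C y))
      by (unfold zI_minus; module_eq).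
    rewrite E.
    eapply Rle_trans; [apply norm_triangle|].
    apply Rplus_le_compat_l, (norm_scal_C (X := X)). }
  pose proof (norm_ge_0 y) as Hy.
  apply Rmult_le_reg_l with K; [lra|].
  replace (K * (5 / 8 * (d + chord t) / K * norm y))
    with (5 / 8 * (d + chord t) * norm y) by (field; lra).
  nra.
- pose proof (TR_resolvent_set T HTR z Hz) as Hres.
  apply (neumann_surjective T HT z w (resolvent z T) (K / Cmod (z - 1))).
  + now apply resolvent_is_resolvent.
  + apply Rdiv_le_0_compat; lra.
  + intros x; pose proof (TR_resolvent_le T HTR z x Hz) as H; fold K in H.
    apply Rmult_le_reg_l with (Cmod (z - 1)); [easy|].
    replace (Cmod (z - 1) * (K / Cmod (z - 1) * norm x)) with (K * norm x)
      by (field; lra); easy.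
  + apply Rmult_lt_reg_r with (Cmod (z - 1)); [easy|].
    replace (Cmod (z - w) * (K / Cmod (z - 1)) * Cmod (z - 1)) with (K * Cmod (z - w))
      by (field; lra); lra.
Qed.

(** The modulus is at most [exp u] with [u = d - chord t / (16 K)], and both [n u] and
    [m u] are at most [n d - m chord t / (16 K)] because [m <= n]. *)
Lemma poly_eval_curve_le c m n t : (m <= n)%nat -> INR n * d <= / 16 -> 0 <= t <= 2 * PI ->
  Cmod (poly_eval c m n (curve radius t)) <=
  exp (/ 16 - INR m * (chord t / (16 * K))) * disc_sup_norm (poly_eval c m n).
Proof.
intros Hmn Hn Ht.
pose proof (chord_range t Ht) as Hc.
pose proof (slope_le (chord t) ltac:(lra)) as Hs.
destruct (rc_pos _ _ _ radial_curve_radius t Ht) as [Hr0 _].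
assert (Em : Cmod (curve radius t) = radius t) by (unfold curve; now apply Cmod_Rmult_cis).
assert (HP : 0 <= disc_sup_norm (poly_eval c m n)).
{ eapply Rle_trans; [apply Cmod_ge_0|apply (poly_eval_le_disc_sup_norm c m n 0%C)].
  rewrite Cmod_0; lra. }
assert (He : radius t <= exp (d - chord t / (16 * K))).
{ unfold radius; pose proof (exp_ineq1_le (d - chord t / (16 * K))); lra. }
assert (Hpow : forall k, radius t ^ k <= exp (INR k * (d - chord t / (16 * K)))).
{ induction k as [|k IH]; [simpl; rewrite Rmult_0_l, exp_0; lra|].
  rewrite S_INR, Rmult_plus_distr_r, Rmult_1_l, Rplus_comm, exp_plus; simpl.
  apply Rmult_le_compat; try easy; now apply pow_le. }
assert (Hmn' : INR m <= INR n) by now apply le_INR.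
pose proof (pos_INR m) as Hm0.
destruct (Rle_dec (radius t) 1) as [H1|H1].
- eapply Rle_trans; [apply poly_eval_le_inside; [easy|lra]|].
  rewrite Em; apply Rmult_le_compat_r; [easy|].
  eapply Rle_trans; [apply Hpow|]; apply exp_le_compat; nra.
- eapply Rle_trans; [apply poly_eval_le_outside; [easy|lra]|].
  rewrite Em; apply Rmult_le_compat_r; [easy|].
  eapply Rle_trans; [apply Hpow|]; apply exp_le_compat.
  unfold radius in H1; nra.
Qed.

End Curve.

(** * The majorant of the integrand and its Riemann sums *)

Section Majorant.
Variables a tau : R.
Hypothesis Ha : 0 < a.
Hypothesis Hat : a < tau.

(** Comparable to [1 / a] up to [a], to [1 / t] from [a] to [tau] and to
    [tau / t^2] beyond; its total integral is exactly [ln (tau / a)]. *)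
Definition log_majorant (t : R) : R := / (t + a) - / (t + tau).
Definition log_primitive (t : R) : R := ln ((t + a) / (t + tau)).

Lemma majorant_eq t : 0 <= t -> log_majorant t = (tau - a) / ((t + a) * (t + tau)).
Proof. intros Ht; unfold log_majorant; field; lra. Qed.

Lemma majorant_ge_0 t : 0 <= t -> 0 <= log_majorant t.
Proof.
intros Ht; rewrite majorant_eq by easy; apply Rdiv_le_0_compat; nra.
Qed.

Lemma ln_ge_1_inv y : 0 < y -> 1 - / y <= ln y.
Proof.
intros Hy; pose proof (exp_ineq1_le (ln (/ y))) as H.
rewrite exp_ln in H by now apply Rinv_0_lt_compat.
rewrite ln_Rinv in H by easy; lra.
Qed.

(** The primitive is concave, so the right-endpoint rule underestimates its
    increments; concretely, this is [ln y >= 1 - 1 / y]. *)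
Lemma majorant_le_primitive s t : 0 <= s <= t ->
  (t - s) * log_majorant t <= log_primitive t - log_primitive s.
Proof.
intros Hst; unfold log_primitive.
assert (P : forall u, 0 <= u -> 0 < (u + a) / (u + tau)).
{ intros u Hu; apply Rdiv_lt_0_compat; lra. }
rewrite <- ln_div by (apply P; lra).
eapply Rle_trans; [|apply ln_ge_1_inv, Rdiv_lt_0_compat; apply P; lra].
rewrite majorant_eq by lra.
replace (1 - / ((t + a) / (t + tau) / ((s + a) / (s + tau))))
  with ((t - s) * ((tau - a) / ((t + a) * (s + tau)))) by (field; lra).
apply Rmult_le_compat_l; [lra|].
apply Rmult_le_compat_l; [lra|].
apply Rinv_le_contravar; [nra|]; apply Rmult_le_compat_l; lra.
Qed.

Lemma primitive_total t : 0 <= t -> log_primitive t - log_primitive 0 <= ln (tau / a).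
Proof.
intros Ht; unfold log_primitive; rewrite !Rplus_0_l.
replace (tau / a) with (/ (a / tau)) by (field; lra).
rewrite ln_Rinv by (apply Rdiv_lt_0_compat; lra).
assert (ln ((t + a) / (t + tau)) <= ln 1); [|rewrite ln_1 in *; lra].
apply ln_le; [apply Rdiv_lt_0_compat; lra|].
apply Rle_div_l; lra.
Qed.

(** A node is the right endpoint of the interval before it; the term at [0], which has
    none, vanishes with the mesh. *)
Lemma majorant_sum_up n :
  sum_n (fun j => 2 * PI / INR (S n) * log_majorant (ang n j)) n <=
  2 * PI / INR (S n) * log_majorant 0 + ln (tau / a).
Proof.
pose proof (INR_S_pos n) as Hn; pose proof PI_RGT_0.
set (h := 2 * PI / INR (S n)).
assert (G : forall k, (k <= n)%nat -> sum_n (fun j => h * log_majorant (ang n j)) k <=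
  h * log_majorant 0 + (log_primitive (ang n k) - log_primitive 0)).
{ induction k as [|k IH]; intros Hk.
  - rewrite sum_O, ang_0; lra.
  - rewrite sum_Sn; change plus with Rplus; specialize (IH ltac:(lia)).
    pose proof (ang_range n k ltac:(lia)); pose proof (ang_range n (S k) ltac:(lia)).
    pose proof (ang_S n k) as E; fold h in E.
    assert (0 <= h) by (apply Rdiv_le_0_compat; lra).
    pose proof (majorant_le_primitive (ang n k) (ang n (S k)) ltac:(lra)) as H3.
    replace (ang n (S k) - ang n k) with h in H3 by lra; lra. }
eapply Rle_trans; [now apply G|].
apply Rplus_le_compat_l, primitive_total; apply ang_range; lia.
Qed.

(** The second half of the curve, where the distance to the argument [2 PI] decreases
    along the nodes. *)
Lemma majorant_sum_down n :
  sum_n (fun j => 2 * PI / INR (S n) * log_majorant (2 * PI - ang n j)) n <= ln (tau / a).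
Proof.
pose proof (INR_S_pos n) as Hn; pose proof PI_RGT_0.
set (h := 2 * PI / INR (S n)).
assert (Hh : 0 <= h) by (apply Rdiv_le_0_compat; lra).
assert (St : forall k, (k <= n)%nat -> h * log_majorant (2 * PI - ang n k) <=
  log_primitive (2 * PI - ang n k) - log_primitive (2 * PI - ang n (S k))).
{ intros k Hk; pose proof (ang_range n k ltac:(lia)).
  pose proof (ang_range n (S k) ltac:(lia)).
  pose proof (ang_S n k) as E; fold h in E.
  pose proof (majorant_le_primitive (2 * PI - ang n (S k)) (2 * PI - ang n k)
    ltac:(lra)) as H3.
  replace (2 * PI - ang n k - (2 * PI - ang n (S k))) with h in H3 by lra; lra. }
assert (G : forall k, (k <= n)%nat -> sum_n (fun j => h * log_majorant (2 * PI - ang n j)) k <=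
  log_primitive (2 * PI) - log_primitive (2 * PI - ang n (S k))).
{ induction k as [|k IH]; intros Hk.
  - rewrite sum_O; specialize (St 0%nat Hk).
    replace (2 * PI - ang n 0) with (2 * PI) in St |- * by (rewrite ang_0; ring); lra.
  - rewrite sum_Sn; change plus with Rplus.
    specialize (IH ltac:(lia)); specialize (St (S k) Hk); lra. }
eapply Rle_trans; [now apply G|].
rewrite ang_last; replace (2 * PI - 2 * PI) with 0 by ring.
apply primitive_total; lra.
Qed.

End Majorant.

Lemma exp_neg_le x : 0 <= x -> exp (- x) <= / (1 + x).
Proof.
intros Hx; rewrite exp_Ropp; apply Rinv_le_contravar; [lra|].
apply exp_ineq1_le.
Qed.

(** * The estimate *)

(** With [c] the chord and [phi] the angular distance to [1], the left-hand side bounds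
    the polynomial times the resolvent on the curve, up to constants.  Trading [m] for
    [m + 1] costs [exp (c / (16 K)) <= exp (1 / 8)] and includes [m = 0], and
    [exp (- y) <= 1 / (1 + y)] turns the decay into a rational factor. *)
Lemma weight_le_majorant (K d a tau phi c : R) (m : nat) :
  1 <= K -> 0 < d -> a = 2 * d -> tau = 32 * K / (INR m + 1) -> 256 * a <= tau ->
  0 <= phi -> phi / 2 <= c <= 2 ->
  exp (/ 16 - INR m * (c / (16 * K))) / (d + c) <=
  512 / 255 * exp (3 / 16) * log_majorant a tau phi.
Proof.
intros HK Hd Ha Htau Hat Hphi Hc.
pose proof (pos_INR m) as Hm.
assert (Ht0 : 0 < tau) by lra.
assert (Hs : 0 <= c / (16 * K) <= 2 / 16).
{ split; [apply Rdiv_le_0_compat; lra|]; apply Rle_div_l; [lra|]; nra. }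
assert (Hy : phi / tau <= (INR m + 1) * (c / (16 * K))).
{ replace (phi / tau) with ((INR m + 1) * (phi / 2 / (16 * K)))
    by (rewrite Htau; field; lra).
  apply Rmult_le_compat_l; [lra|]; apply Rmult_le_compat_r; [|lra].
  left; apply Rinv_0_lt_compat; lra. }
assert (Hpt : 0 <= phi / tau) by (apply Rdiv_le_0_compat; lra).
assert (He : exp (/ 16 - INR m * (c / (16 * K))) <= exp (3 / 16) * (tau / (tau + phi))).
{ replace (/ 16 - INR m * (c / (16 * K)))
    with ((/ 16 + c / (16 * K)) + - ((INR m + 1) * (c / (16 * K)))) by ring.
  rewrite exp_plus; apply Rmult_le_compat; try (left; apply exp_pos).
  - apply exp_le_compat; lra.
  - eapply Rle_trans; [apply exp_neg_le; lra|].
    replace (tau / (tau + phi)) with (/ (1 + phi / tau)) by (field; lra).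
    apply Rinv_le_contravar; lra. }
assert (Hi : / (d + c) <= 2 / (phi + a)).
{ replace (2 / (phi + a)) with (/ ((phi + a) / 2)) by (field; lra).
  apply Rinv_le_contravar; lra. }
unfold Rdiv at 1.
eapply Rle_trans.
{ apply Rmult_le_compat; [left; apply exp_pos| |exact He|exact Hi].
  left; apply Rinv_0_lt_compat; lra. }
rewrite majorant_eq by lra.
replace (exp (3 / 16) * (tau / (tau + phi)) * (2 / (phi + a)))
  with (exp (3 / 16) * (2 * tau) * / ((phi + a) * (phi + tau))) by (field; lra).
replace (512 / 255 * exp (3 / 16) * ((tau - a) / ((phi + a) * (phi + tau))))
  with (exp (3 / 16) * (512 / 255 * (tau - a)) * / ((phi + a) * (phi + tau)))
  by (field; nra).
apply Rmult_le_compat_r; [left; apply Rinv_0_lt_compat; nra|].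
apply Rmult_le_compat_l; [left; apply exp_pos|lra].
Qed.

Lemma exp_constant_le : 9 / 5 * (512 / 255 * exp (3 / 16)) <= 2 * exp 1.
Proof.
replace 1 with (3 / 16 + 13 / 16) at 1 by field; rewrite exp_plus.
pose proof (exp_pos (3 / 16)); pose proof (exp_ineq1_le (13 / 16)); nra.
Qed.

Lemma ln_256_le : ln 256 <= 6.
Proof.
assert (E8 : 2 <= exp (3 / 4)).
{ replace (3 / 4) with (3 / 32 + 3 / 32 + (3 / 32 + 3 / 32)
    + (3 / 32 + 3 / 32 + (3 / 32 + 3 / 32))) by field.
  rewrite !exp_plus; pose proof (exp_ineq1_le (3 / 32)) as H.
  assert (H2 : 119 / 100 <= exp (3 / 32) * exp (3 / 32)) by nra.
  assert (H4 : 1416 / 1000 <= exp (3 / 32) * exp (3 / 32) * (exp (3 / 32) * exp (3 / 32)))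
    by nra.
  nra. }
replace 256 with (2 ^ 8) by ring; rewrite ln_pow by lra.
assert (ln 2 <= 3 / 4) by (rewrite <- (ln_exp (3 / 4)); apply ln_le; lra).
simpl INR; lra.
Qed.

Section Estimate.
Context {X : CompleteNormedModule C_AbsRing}.
Variable T : X -> X.
Hypothesis HTR : Tadmor_Ritt T.
Let K := real (TR_const T).
Hypothesis HK : 1 <= K.
Variables (m n : nat) (c : nat -> C).
Hypothesis Hmn : (m <= n)%nat.
Let P := disc_sup_norm (poly_eval c m n).

(** The curve has length at most [9 / 8] times its angle, and its two halves contribute
    [ln (tau / a)] each; since the bound holds for every mesh, it passes to the limit. *)
Lemma poly_op_le x : norm x <= 1 ->
  norm (poly_op c m n T x) <=
  2 * exp 1 / PI * K * ln (256 * K * ((INR n + 1) / (INR m + 1))) * P.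
Proof.
intros Hx; pose proof (proj1 HTR) as HT.
pose proof PI_RGT_0 as HPI; pose proof (pos_INR m) as Hm0.
assert (Hmn' : INR m <= INR n) by now apply le_INR.
(* Of order [1 / n], so that [|z|^n] stays bounded on the curve. *)
set (d := / (16 * (INR n + 1))).
assert (Hd : 0 < d <= / 16).
{ split; [apply Rinv_0_lt_compat; lra|]; apply Rinv_le_contravar; lra. }
assert (Hnd : INR n * d <= / 16).
{ unfold d; apply Rle_div_l; [lra|]; lra. }
set (a := 2 * d); set (tau := 32 * K / (INR m + 1)).
assert (Ha : 0 < a) by (unfold a; lra).
assert (Hat : 256 * a <= tau).
{ replace (256 * a) with (32 * / (INR n + 1)) by (unfold a, d; field; lra).
  apply Rmult_le_compat; [lra|left; apply Rinv_0_lt_compat; lra|lra|].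
  apply Rinv_le_contravar; lra. }
assert (Hta : tau / a = 256 * K * ((INR n + 1) / (INR m + 1)))
  by (unfold tau, a, d; field; lra).
rewrite <- Hta.
assert (HP : 0 <= P).
{ eapply Rle_trans; [apply Cmod_ge_0|apply (poly_eval_le_disc_sup_norm c m n 0%C)].
  rewrite Cmod_0; lra. }
set (rho := radius T d).
assert (Hrho : radial_curve rho (1 + d) (/ 16)) by now apply radial_curve_radius.
set (lam := ln (tau / a)).
set (A := 9 / 8 * (8 / 5 * K * P * (512 / 255 * exp (3 / 16)))).
assert (HA0 : 0 <= 8 / 5 * K * P).
{ apply Rmult_le_pos; [lra|easy]. }
assert (Hlim : norm (scal (2 * PI * Ci)%C (poly_op c m n T x)) <= A * (2 * lam)).
{ apply (seq_to_norm_le (X := X)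
    (fun l => left_sum rho l (fun z => scal (poly_eval c m n z) (resolvent z T x))) _
    (fun l => A * (2 * PI * log_majorant a tau 0 / INR (S l) + 2 * lam))).
  - apply (cauchy_value_poly (X := X) T HT (fun z => resolvent z T) rho (1 + d) (/ 16)
      (8 / 5 * K / d) Hrho ltac:(lra)).
    + apply Rdiv_le_0_compat; lra.
    + intros z [t [r [Ht [Hr ->]]]].
      apply resolvent_is_resolvent.
      apply (TR_resolvent_outside T HTR HK d Hd t r Ht Hr).
    + intros z [t [r [Ht [Hr ->]]]] y.
      eapply Rle_trans; [apply (TR_resolvent_outside T HTR HK d Hd t r Ht Hr)|].
      apply Rmult_le_compat_r; [apply norm_ge_0|].
      apply Rmult_le_compat_l; [lra|]; apply Rinv_le_contravar; [lra|].
      pose proof (chord_range t Ht); lra.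
  - intros l; pose proof (INR_S_pos l) as Hl.
    set (h := 2 * PI / INR (S l)).
    assert (Hh : 0 <= h) by (apply Rdiv_le_0_compat; lra).
    pose proof (majorant_sum_up a tau Ha ltac:(lra) l) as M1.
    pose proof (majorant_sum_down a tau Ha ltac:(lra) l) as M2.
    fold h lam in M1, M2.
    apply Rle_trans with (sum_n (fun j => A * (h * log_majorant a tau (ang l j)
      + h * log_majorant a tau (2 * PI - ang l j))) l).
    + apply (norm_sum_n_le (X := X)); intros j Hj.
      pose proof (ang_range l j ltac:(lia)) as Ht.
      pose proof (radial_curve_step _ _ _ l j Hrho Hj) as Hs; fold h in Hs.
      pose proof (poly_eval_curve_le T HK d Hd c m n (ang l j) Hmn Hnd Ht) as Hp.
      pose proof (proj2 (TR_resolvent_outside T HTR HK d Hd (ang l j) _ Ht (Rle_refl _)) x)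
        as HR.
      fold rho P in Hp; fold rho K in HR.
      change (RtoC (rho (ang l j)) * cis (ang l j))%C with (curve rho (ang l j)) in HR.
      set (t := ang l j) in *; set (z := curve rho t) in *.
      pose proof (chord_range t Ht) as Hc.
      eapply Rle_trans; [apply (norm_scal_C (X := X))|].
      eapply Rle_trans; [apply Rmult_le_compat_l; [apply Cmod_ge_0|
        apply (norm_scal_C (X := X))]|].
      set (w := exp (/ 16 - INR m * (chord t / (16 * K))) / (d + chord t)).
      assert (Hw : w <= 512 / 255 * exp (3 / 16) *
        (log_majorant a tau t + log_majorant a tau (2 * PI - t))).
      { pose proof (majorant_ge_0 a tau Ha ltac:(lra) t ltac:(lra)).
        pose proof (majorant_ge_0 a tau Ha ltac:(lra) (2 * PI - t) ltac:(lra)).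
        pose proof (exp_pos (3 / 16)).
        (* Only the term of the nearer end of the angular range is needed. *)
        destruct (Rle_dec t PI) as [HtP|HtP].
        - pose proof (chord_ge_half t ltac:(lra)).
          eapply Rle_trans; [apply (weight_le_majorant K d a tau t (chord t) m);
            try easy; lra|].
          apply Rmult_le_compat_l; lra.
        - pose proof (chord_ge_half (2 * PI - t) ltac:(lra)) as Hch.
          rewrite chord_sym in Hch.
          eapply Rle_trans; [apply (weight_le_majorant K d a tau (2 * PI - t) (chord t) m);
            try easy; lra|].
          apply Rmult_le_compat_l; lra. }
      assert (Hprod : Cmod (poly_eval c m n z) * norm (resolvent z T x)
        <= 8 / 5 * K * P * w).
      { replace (8 / 5 * K * P * w) with
          (exp (/ 16 - INR m * (chord t / (16 * K))) * P * (8 / 5 * K / (d + chord t) * 1))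
          by (unfold w; field; lra).
        apply Rmult_le_compat; [apply Cmod_ge_0|apply norm_ge_0|exact Hp|].
        eapply Rle_trans; [exact HR|].
        apply Rmult_le_compat_l; [apply Rdiv_le_0_compat; lra|easy]. }
      assert (Hs' : Cmod (curve rho (ang l (S j)) - z) <= 9 / 8 * h).
      { eapply Rle_trans; [exact Hs|]; apply Rmult_le_compat_r; lra. }
      assert (Hw' : 8 / 5 * K * P * w <= 8 / 5 * K * P * (512 / 255 * exp (3 / 16) *
        (log_majorant a tau t + log_majorant a tau (2 * PI - t)))) by now apply Rmult_le_compat_l.
      replace (A * (h * log_majorant a tau t + h * log_majorant a tau (2 * PI - t)))
        with (9 / 8 * h * (8 / 5 * K * P * (512 / 255 * exp (3 / 16) *
          (log_majorant a tau t + log_majorant a tau (2 * PI - t))))) by (unfold A; ring).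
      apply Rmult_le_compat; [apply Cmod_ge_0| |exact Hs'|lra].
      apply Rmult_le_pos; [apply Cmod_ge_0|apply norm_ge_0].
    + refine (Rle_trans _ _ _ (Req_le _ _ (sum_n_mult_l (K := R_Ring) A _ l)) _).
      change mult with Rmult.
      apply Rmult_le_compat_l.
      { unfold A; pose proof (exp_pos (3 / 16)).
        apply Rmult_le_pos; [lra|]; apply Rmult_le_pos; lra. }
      refine (Rle_trans _ _ _ (Req_le _ _ (sum_n_plus (G := R_AbelianMonoid) _ _ l)) _).
      change plus with Rplus.
      replace (2 * PI * log_majorant a tau 0 / INR (S l)) with (h * log_majorant a tau 0)
        by (unfold h; field; lra).
      lra.
  - replace (Finite (A * (2 * lam))) with (Rbar_mult A (0 + 2 * lam))
      by (simpl; f_equal; ring).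
    apply is_lim_seq_scal_l, is_lim_seq_plus'; [apply is_lim_seq_div_INR|].
    apply is_lim_seq_const. }
assert (Hlam : 0 <= lam).
{ unfold lam; rewrite <- ln_1; apply ln_le; [lra|]; apply Rle_div_r; lra. }
rewrite (norm_scal_eq (X := X)) in Hlim.
rewrite !Cmod_mult, Cmod_Ci, !Cmod_R, !Rabs_pos_eq, Rmult_1_r in Hlim by lra.
apply Rmult_le_reg_l with (2 * PI); [lra|].
eapply Rle_trans; [exact Hlim|].
replace (2 * PI * (2 * exp 1 / PI * K * lam * P))
  with (2 * exp 1 * (K * P * (2 * lam))) by (field; lra).
replace (A * (2 * lam)) with (9 / 5 * (512 / 255 * exp (3 / 16)) * (K * P * (2 * lam)))
  by (unfold A; field).
apply Rmult_le_compat_r; [|apply exp_constant_le].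
apply Rmult_le_pos; [apply Rmult_le_pos; lra|lra].
Qed.

End Estimate.

Theorem theorem2p5 :
  forall s : R, 0 < s < 1 ->
  let a := 2 * exp 1 / (PI * (1 - s)) in
  let b := - 2 * ln s + 6 in
  forall (X : CompleteNormedModule C_AbsRing) (hX : exists x : X, x <> zero)
    (T : X -> X) (hT : Tadmor_Ritt T)
    (m n : nat) (hmn : (m <= n)%nat) (c : nat -> C),
  op_norm (poly_op c m n T) <=
    a * real (TR_const T) *
      (2 * ln (real (TR_const T)) + b + ln ((INR n + 1) / (INR m + 1))) *
      disc_sup_norm (poly_eval c m n).
Proof.
intros s Hs a b X hX T hT m n hmn c.
pose proof (TR_const_ge_1 T hT hX) as HK.
pose proof (poly_op_le T hT HK m n c hmn) as Hop.
set (K := real (TR_const T)) in *; set (P := disc_sup_norm _) in *.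
assert (HP : 0 <= P).
{ eapply Rle_trans; [apply Cmod_ge_0|apply (poly_eval_le_disc_sup_norm c m n 0%C)].
  rewrite Cmod_0; lra. }
pose proof PI_RGT_0 as HPI; pose proof (exp_pos 1) as He.
assert (Hm : 0 <= INR m <= INR n) by (split; [apply pos_INR|now apply le_INR]).
set (q := (INR n + 1) / (INR m + 1)) in *.
assert (Hq : 1 <= q) by (apply Rle_div_r; lra).
assert (Hln : ln (256 * K * q) = ln 256 + ln K + ln q) by (rewrite !ln_mult; nra).
assert (HlK : 0 <= ln K) by (rewrite <- ln_1; apply ln_le; lra).
assert (Hlq : 0 <= ln q) by (rewrite <- ln_1; apply ln_le; lra).
assert (Hls : ln s <= 0) by (rewrite <- ln_1; apply ln_le; lra).
assert (Hl256 : 0 <= ln 256) by (rewrite <- ln_1; apply ln_le; lra).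
pose proof ln_256_le as H256.
assert (Ha : 2 * exp 1 / PI <= a).
{ unfold a; apply Rmult_le_compat_l; [lra|]; apply Rinv_le_contravar; nra. }
assert (Ha0 : 0 <= 2 * exp 1 / PI) by (apply Rdiv_le_0_compat; lra).
assert (Hle : 2 * exp 1 / PI * K * ln (256 * K * q) * P
  <= a * K * (2 * ln K + b + ln q) * P).
{ apply Rmult_le_compat_r; [easy|]; apply Rmult_le_compat.
  - apply Rmult_le_pos; lra.
  - lra.
  - apply Rmult_le_compat_r; lra.
  - unfold b; lra. }
apply op_norm_le.
- eapply Rle_trans; [|exact Hle].
  apply Rmult_le_pos; [|easy]; apply Rmult_le_pos; [apply Rmult_le_pos|]; lra.
- intros x Hx; eapply Rle_trans; [|exact Hle]; now apply Hop.
Qed.
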